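(* Let $R$ be a commutative unital ring, $k\ge1$, let $M_0,\dots,M_k,N_0,\dots,N_k$ be $R$-modules, and let $\Omega^{(j)}\subseteq M_{j,\mathrm{nc}}$, $j=0,\dots,k$, be right admissible nc sets. For $j=0,\dots,k$ let $$F_j\in\mathcal T^{k+1}(\Omega^{(0)},\dots,\Omega^{(j-1)},\Omega^{(j)},\Omega^{(j)},\Omega^{(j+1)},\dots,\Omega^{(k)};N_{0,\mathrm{nc}},\dots,N_{j,\mathrm{nc}},M_{j,\mathrm{nc}},N_{j+1,\mathrm{nc}},\dots,N_{k,\mathrm{nc}}).$$ Then there exists $f\in\mathcal T^k(\Omega^{(0)},\dots,\Omega^{(k)};N_{0,\mathrm{nc}},\dots,N_{k,\mathrm{nc}})$ such that ${}_j\Delta f=F_j$ for $j=0,\dots,k$ if and only if ${}_i\Delta F_j={}_{j+1}\Delta F_i$ for all $0\le i\le j\le k$. Further, $f$ is uniquely determined up to a $k$-linear mapping: if $\tilde f$ is another nc function of order $k$ with ${}_j\Delta\tilde f=F_j$ for $j=0,\dots,k$, then there is a $k$-linear mapping $c:N_1\times\cdots\times N_k\to N_0$ such that $$\tilde f(X^0,\dots,X^k)(Z^1,\dots,Z^k)=f(X^0,\dots,X^k)(Z^1,\dots,Z^k)+C(Z^1,\dots,Z^k),$$ where for $X^j\in\Omega^{(j)}_{n_j}$ and $Z^j\in N_j^{n_{j-1}\times n_j}$, $C(Z^1,\dots,Z^k)\in N_0^{n_0\times n_k}$ is the matrix whose $(\alpha_0,\alpha_k)$ entry is $$\sum_{\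alpha_1=1}^{n_1}\cdots\sum_{\alpha_{k-1}=1}^{n_{k-1}}c(Z^1_{\alpha_0,\alpha_1},\dots,Z^k_{\alpha_{k-1},\alpha_k}).$$
   Context: $R$ is a commutative unital ring; matrices over $R$ multiply matrices over an $R$-module in the usual way. For an $R$-module $M$, $M_{\mathrm{nc}}=\bigsqcup_{n\ge1}M^{n\times n}$. A subset $\Omega\subseteq M_{\mathrm{nc}}$ is an nc set if $X\oplus Y\in\Omega$ (block diagonal sum) whenever $X,Y\in\Omega$; $\Omega_n=\Omega\cap M^{n\times n}$. It is right admissible if for all $X\in\Omega_n$, $Y\in\Omega_m$, $Z\in M^{n\times m}$ there is an invertible $r\in R$ with $\begin{bmatrix}X&rZ\\ 0&Y\end{bmatrix}\in\Omega_{n+m}$. nc functions of order $k\ge1$: $f\in\mathcal T^k(\Omega^{(0)},\dots,\Omega^{(k)};N_{0,\mathrm{nc}},\dots,N_{k,\mathrm{nc}})$ means that for $X^j\in\Omega^{(j)}_{n_j}$, $f(X^0,\dots,X^k):N_1^{n_0\times n_1}\times\cdots\times N_k^{n_{k-1}\times n_k}\to N_0^{n_0\times n_k}$ is $k$-linear over $R$, and $f$ respects intertwinings (equivalently, direct sums and similarities): for matrices $T$ over $R$ and all arguments of appropriate sizes, (i) $TX^0=\tilde X^0T$ implies $Tf(X^0,X^1,\dots,X^k)(Z^1,\dots,Z^k)=f(\tilde X^0,X^1,\dots,X^k)(TZ^1,Z^2,\dots,Z^k)$; (ii) for $0<j<k$, $TX^j=\tilde X^jT$ implies $f(\dots,X^j,\dots)(Z^1,\dots,Z^jT,Z^{j+1},\dots,Z^k)=f(\dots,\tilde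 X^j,\dots)(Z^1,\dots,Z^j,TZ^{j+1},\dots,Z^k)$; (iii) $TX^k=\tilde X^kT$ implies $f(\dots,X^k)(Z^1,\dots,Z^{k-1},Z^kT)=f(\dots,\tilde X^k)(Z^1,\dots,Z^k)T$. Difference-differential operators (right admissible nc sets). For $f$ of order $k\ge1$ and $0\le j\le k$, ${}_j\Delta f$ is the nc function of order $k+1$ in which the $j$-th point argument is replaced by two points $X^j_1,X^j_2\in\Omega^{(j)}$ and a matrix argument $Z$ over $M_j$ is inserted after $Z^j$; writing $P=\begin{bmatrix}X^j_1&Z\\ 0&X^j_2\end{bmatrix}$, it is determined by ${}_0\Delta f(X^0_1,X^0_2,X^1,\dots,X^k)(Z,Z^1,\dots,Z^k)=\begin{bmatrix}I&0\end{bmatrix}f(P,X^1,\dots,X^k)\left(\begin{bmatrix}0\\ Z^1\end{bmatrix},Z^2,\dots,Z^k\right)$; for $0<j<k$, ${}_j\Delta f(X^0,\dots,X^j_1,X^j_2,\dots,X^k)(Z^1,\dots,Z^j,Z,Z^{j+1},\dots,Z^k)=f(X^0,\dots,P,\dots,X^k)\left(Z^1,\dots,Z^{j-1},\begin{bmatrix}Z^j&0\end{bmatrix},\begin{bmatrix}0\\ Z^{j+1}\end{bmatrix},Z^{j+2},\dots,Z^k\right)$; ${}_k\Delta f(X^0,\dots,X^{k-1},X^k_1,X^k_2)(Z^1,\dots,Z^k,Z)=f(X^0,\dots,X^{k-1},P)(Z^1,\dots,Z^{k-1},\begin{bmatrix}Z^k&0\end{bmatrix})\begin{bmatrix}0\\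 I\end{bmatrix}$. These are used when $P\in\Omega^{(j)}$; for general $Z$ one replaces $Z$ by $rZ$ with $r\in R$ invertible such that the block matrix lies in $\Omega^{(j)}$ and divides the result by $r$ (this is independent of $r$ and linear in $Z$). The operators ${}_i\Delta$ on functions of order $k+1$ are defined in the same way. *)

(* Defs.v *)
From Stdlib Require Import ClassicalEpsilon.
From HB Require Import structures.
From mathcomp Require Import all_boot all_order all_algebra.

Set Implicit Arguments.
Unset Strict Implicit.
Unset Printing Implicit Defensive.

Import GRing.Theory.
Local Open Scope ring_scope.

Section ModuleMatrices.
Variables (R : comPzRingType) (V : lmodType R).

(* The products T X and X T, and the scalar multiple r X, for T a matrix over R,
   r in R and X a matrix over the R-module V. *)
Definition lmulmx (m n p : nat) (T : 'M[R]_(m, n)) (X : 'M[V]_(n, p)) : 'M[V]_(m, p) :=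
  \matrix_(i, l) \sum_j T i j *: X j l.

Definition rmulmx (m n p : nat) (X : 'M[V]_(m, n)) (T : 'M[R]_(n, p)) : 'M[V]_(m, p) :=
  \matrix_(i, l) \sum_j T j l *: X i j.

Definition sclmx (m n : nat) (r : R) (X : 'M[V]_(m, n)) : 'M[V]_(m, n) :=
  map_mx (fun v => r *: v) X.

Definition ncsubset := forall n : nat, 'M[V]_n -> Prop.

(* The first clause says that Om is a subset of V_nc, where sizes start at 1. *)
Definition nc_set (Om : ncsubset) : Prop :=
  (forall (n : nat) (X : 'M[V]_n), Om n X -> (0 < n)%N) /\
  (forall (n m : nat) (X : 'M[V]_n) (Y : 'M[V]_m),
     Om n X -> Om m Y -> Om (n + m)%N (block_mx X 0 0 Y)).

Definition invertible (r : R) : Prop := exists s : R, r * s = 1.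

Definition right_admissible (Om : ncsubset) : Prop :=
  forall (n m : nat) (X : 'M[V]_n) (Y : 'M[V]_m) (Z : 'M[V]_(n, m)),
    Om n X -> Om m Y ->
    exists r : R, invertible r /\ Om (n + m)%N (block_mx X (sclmx r Z) 0 Y).

(* A pair (r, r^-1) such that [X rZ; 0 Y] lies in Om. *)
Definition adm_scale (Om : ncsubset) (n m : nat)
    (X : 'M[V]_n) (Z : 'M[V]_(n, m)) (Y : 'M[V]_m) : R * R :=
  epsilon (inhabits (1, 1))
    (fun r => r.1 * r.2 = 1 /\ Om (n + m)%N (block_mx X (sclmx r.1 Z) 0 Y)).

End ModuleMatrices.

(* Signatures.  A function of order k has point arguments X^0, ..., X^k and matrix
   arguments Z^1, ..., Z^k.  Its signature consists of the domain (M_0, Om^(0)) of X^0,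
   the module N_0 of values, and the list, for j = 1, ..., k, of the slots
   ((M_j, Om^(j)), N_j) describing the pair (X^j, Z^j). *)
Record domain (R : comPzRingType) := Domain {
  dmod : lmodType R;
  dset : ncsubset dmod }.
Arguments dset {R} d n X.

Record slot (R : comPzRingType) := Slot {
  sdom : domain R;
  smod : lmodType R }.

Definition slots (R : comPzRingType) (k : nat) (M N : 'I_k.+1 -> lmodType R)
    (Om : forall j, ncsubset (M j)) : seq (slot R) :=
  [seq Slot (Domain (Om (lift ord0 j))) (N (lift ord0 j)) | j <- enum 'I_k].

(* [dup P s j] is the signature of the j-th difference-differential of f when f has points in P and slots s: the
   j-th point is doubled, and between the two copies there is a matrix argument over M_j.
   [dupl s j] does so for the point of the j-th slot of s, counting slots from 0. *)
Fixpoint dupl (R : comPzRingType) (s : seq (slot R)) (j : nat) : seq (slot R) :=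
  match s with
  | [::] => [::]
  | c :: s' => c :: (match j with
                     | 0%N => Slot (sdom c) (dmod (sdom c)) :: s'
                     | j'.+1 => dupl s' j'
                     end)
  end.

Definition dup (R : comPzRingType) (P : domain R) (s : seq (slot R)) (j : nat) :=
  match j with
  | 0%N => Slot P (dmod P) :: s
  | j'.+1 => dupl s j'
  end.

Lemma duplC (R : comPzRingType) (s : seq (slot R)) (i j : nat) :
  (i <= j)%N -> dupl (dupl s i) j.+1 = dupl (dupl s j) i.
Proof.
elim: s i j => [|c s IHs] [|i] [|j] //= hij.
exact: (congr1 (cons c) (IHs i j hij)).
Defined.

Lemma dupC (R : comPzRingType) (P : domain R) (s : seq (slot R)) (i j : nat) :
  (i <= j)%N -> dup P (dup P s i) j.+1 = dup P (dup P s j) i.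
Proof.
case: i j => [|i] [|j] //= hij.
exact: (@duplC R s i j hij).
Defined.

(* [nctail N0 a s n]: functions of the remaining arguments (X^{j+1}, Z^{j+1}), ...,
   (X^k, Z^k), described by s, when X^0 has size a and X^j has size n.  Point and matrix
   arguments are interleaved, each point being preceded by its size. *)
Fixpoint nctail (R : comPzRingType) (N0 : lmodType R) (a : nat) (s : seq (slot R))
    (n : nat) : Type :=
  match s with
  | [::] => 'M[N0]_(a, n)
  | c :: s' => forall (m : nat) (X : 'M[dmod (sdom c)]_m) (Z : 'M[smod c]_(n, m)),
                 nctail N0 a s' m
  end.

(* Values at points outside of the domains are irrelevant. *)
Definition ncfun (R : comPzRingType) (P : domain R) (N0 : lmodType R) (s : seq (slot R)) :=
  forall (n : nat) (X : 'M[dmod P]_n), nctail N0 n s n.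

(* Lists of arguments for a tail, with points in the domains. *)
Record arg (R : comPzRingType) (c : slot R) (n : nat) := Arg {
  asize : nat;
  apoint : 'M[dmod (sdom c)]_asize;
  apointP : dset (sdom c) asize apoint;
  amat : 'M[smod c]_(n, asize) }.

Fixpoint args (R : comPzRingType) (s : seq (slot R)) (n : nat) : Type :=
  match s with
  | [::] => unit
  | c :: s' => {x : arg c n & args s' (asize x)}
  end.

(* The size of the last point. *)
Fixpoint last_size (R : comPzRingType) (s : seq (slot R)) : forall n, args s n -> nat :=
  match s with
  | [::] => fun n _ => n
  | c :: s' => fun n x => last_size (projT2 x)
  end.

Fixpoint app (R : comPzRingType) (N0 : lmodType R) (a : nat) (s : seq (slot R)) :
    forall n, nctail N0 a s n -> forall x : args s n, 'M[N0]_(a, last_size x) :=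
  match s with
  | [::] => fun n G _ => G
  | c :: s' => fun n G x =>
      app (G (asize (projT1 x)) (apoint (projT1 x)) (amat (projT1 x))) (projT2 x)
  end.

Definition nceq (R : comPzRingType) (P : domain R) (N0 : lmodType R) (s : seq (slot R))
    (f g : ncfun P N0 s) : Prop :=
  forall (n : nat) (X : 'M[dmod P]_n), dset P n X ->
  forall x : args s n, app (f n X) x = app (g n X) x.

Fixpoint tail_map (R : comPzRingType) (N0 : lmodType R) (a b : nat)
    (phi : forall m, 'M[N0]_(a, m) -> 'M[N0]_(b, m)) (s : seq (slot R)) :
    forall n, nctail N0 a s n -> nctail N0 b s n :=
  match s with
  | [::] => fun n G => phi n G
  | c :: s' => fun n G m X Z => tail_map phi (G m X Z)
  end.

Fixpoint linear_tail (R : comPzRingType) (N0 : lmodType R) (a : nat) (s : seq (slot R)) :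
    forall n, nctail N0 a s n -> Prop :=
  match s with
  | [::] => fun _ _ => True
  | c :: s' => fun n G =>
      forall (m : nat) (X : 'M[dmod (sdom c)]_m), dset (sdom c) m X ->
      (forall (r : R) (Z Z' : 'M[smod c]_(n, m)) (x : args s' m),
         app (G m X (sclmx r Z + Z')) x = sclmx r (app (G m X Z) x) + app (G m X Z') x) /\
      (forall Z : 'M[smod c]_(n, m), linear_tail (G m X Z))
  end.

(* Moving T out of the last supplied argument: G(Z, ...) = G'(T Z, ...) if there is a next
   matrix argument Z, and G = G' T if there is none. *)
Definition shift_tail (R : comPzRingType) (N0 : lmodType R) (a : nat) (s : seq (slot R))
    (n n' : nat) (T : 'M[R]_(n', n)) : nctail N0 a s n -> nctail N0 a s n' -> Prop :=
  match s with
  | [::] => fun G G' => G = rmulmx G' T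
  | c :: s' => fun G G' =>
      forall (m : nat) (X : 'M[dmod (sdom c)]_m), dset (sdom c) m X ->
      forall (Z : 'M[smod c]_(n, m)) (x : args s' m),
        app (G m X Z) x = app (G' m X (lmulmx T Z)) x
  end.

(* Conditions (ii) and (iii) on intertwinings, for each point of a slot in s. *)
Fixpoint respects_tail (R : comPzRingType) (N0 : lmodType R) (a : nat) (s : seq (slot R)) :
    forall n, nctail N0 a s n -> Prop :=
  match s with
  | [::] => fun _ _ => True
  | c :: s' => fun n G =>
      (forall (m m' : nat) (X : 'M[dmod (sdom c)]_m) (X' : 'M[dmod (sdom c)]_m')
          (T : 'M[R]_(m', m)),
         dset (sdom c) m X -> dset (sdom c) m' X' -> lmulmx T X = rmulmx X' T ->
         forall Z : 'M[smod c]_(n, m'),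
           shift_tail T (G m X (rmulmx Z T)) (G m' X' Z)) /\
      (forall (m : nat) (X : 'M[dmod (sdom c)]_m), dset (sdom c) m X ->
       forall Z : 'M[smod c]_(n, m), respects_tail (G m X Z))
  end.

(* The first clause is condition (i): T f(X, ...)(Z^1, ...) = f(X', ...)(T Z^1, ...). *)
Definition respects_intertwinings (R : comPzRingType) (P : domain R) (N0 : lmodType R)
    (s : seq (slot R)) (f : ncfun P N0 s) : Prop :=
  (forall (n n' : nat) (X : 'M[dmod P]_n) (X' : 'M[dmod P]_n') (T : 'M[R]_(n', n)),
     dset P n X -> dset P n' X' -> lmulmx T X = rmulmx X' T ->
     shift_tail T (tail_map (fun m Y => lmulmx T Y) (f n X)) (f n' X')) /\
  (forall (n : nat) (X : 'M[dmod P]_n), dset P n X -> respects_tail (f n X)).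

Definition is_nc (R : comPzRingType) (P : domain R) (N0 : lmodType R) (s : seq (slot R))
    (f : ncfun P N0 s) : Prop :=
  (forall (n : nat) (X : 'M[dmod P]_n), dset P n X -> linear_tail (f n X)) /\
  respects_intertwinings f.

(* Replaces the next matrix argument Z by [0; Z] or, if there is none, multiplies the
   value on the right by [0; I]. *)
Definition lower_tail (R : comPzRingType) (N0 : lmodType R) (a : nat) (s : seq (slot R))
    (n1 n2 : nat) : nctail N0 a s (n1 + n2) -> nctail N0 a s n2 :=
  match s with
  | [::] => fun G => rsubmx G
  | c :: s' => fun G m X Z => G m X (col_mx 0 Z)
  end.

(* For nc functions the values of [Delta_tail] and [Delta] do not depend on the pair
   chosen by [adm_scale]. *)
Fixpoint Delta_tail (R : comPzRingType) (N0 : lmodType R) (a : nat) (s : seq (slot R))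
    (j : nat) : forall n, nctail N0 a s n -> nctail N0 a (dupl s j) n :=
  match s with
  | [::] => fun n G => G
  | c :: s' =>
      match j with
      | 0%N => fun n G m1 X1 Z m2 X2 W =>
          let r := adm_scale (dset (sdom c)) X1 W X2 in
          tail_map (fun m Y => sclmx r.2 Y)
            (lower_tail (G (m1 + m2)%N (block_mx X1 (sclmx r.1 W) 0 X2) (row_mx Z 0)))
      | j'.+1 => fun n G m X Z => Delta_tail j' (G m X Z)
      end
  end.

Definition Delta (R : comPzRingType) (P : domain R) (N0 : lmodType R) (s : seq (slot R))
    (j : nat) (f : ncfun P N0 s) : ncfun P N0 (dup P s j) :=
  match j with
  | 0%N => fun n1 X1 n2 X2 W =>
      let r := adm_scale (dset P) X1 W X2 in
      tail_map (fun m Y => sclmx r.2 (usubmx Y))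
        (lower_tail (f (n1 + n2)%N (block_mx X1 (sclmx r.1 W) 0 X2)))
  | j'.+1 => fun n X => Delta_tail j' (f n X)
  end.

(* The product N_1 x ... x N_k. *)
Fixpoint vals (R : comPzRingType) (s : seq (slot R)) : Type :=
  match s with
  | [::] => unit
  | c :: s' => (smod c * vals s')%type
  end.

Fixpoint klinear (R : comPzRingType) (N0 : lmodType R) (s : seq (slot R)) :
    (vals s -> N0) -> Prop :=
  match s with
  | [::] => fun _ => True
  | d :: s' => fun c =>
      (forall (r : R) (u v : smod d) (w : vals s'),
         c (r *: u + v, w) = r *: c (u, w) + c (v, w)) /\
      (forall u : smod d, klinear (fun w => c (u, w)))
  end.

(* The sum over alpha_1, ..., alpha_{k-1} of c(Z^1_{alpha_0 alpha_1}, ...,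
   Z^k_{alpha_{k-1} alpha_k}); the case of an empty s is a convention. *)
Fixpoint path_sum (R : comPzRingType) (N0 : lmodType R) (s : seq (slot R)) :
    (vals s -> N0) -> forall (n : nat) (x : args s n), 'I_n -> 'I_(last_size x) -> N0 :=
  match s with
  | [::] => fun c n x alpha omega => if alpha == omega then c tt else 0
  | d :: s' =>
      (match s' return
         ((vals s' -> N0) -> forall n (x : args s' n), 'I_n -> 'I_(last_size x) -> N0) ->
         (vals (d :: s') -> N0) ->
         forall n (x : args (d :: s') n), 'I_n -> 'I_(last_size x) -> N0
       with
       | [::] => fun _ c n x alpha omega => c (amat (projT1 x) alpha omega, tt)
       | _ => fun path_sum' c n x alpha omega =>
           \sum_beta path_sum' (fun w => c (amat (projT1 x) alpha beta, w))
                               _ (projT2 x) beta omega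
       end) (@path_sum R N0 s')
  end.
Arguments path_sum {R N0 s} c {n} x alpha omega.

(* Main.v *)
(* A row over R acting on the left of the values of f gives one more slot (see [tail_of]), after
   which all points of f are points of slots and can be treated alike.  For matrices S over R
   of any shape, the j-th difference-differential satisfies
     f(.., X, ..)(.., Z S, ..) - f(.., X', ..)(.., Z, S .., ..)
       = (j Delta f)(.., X', X, ..)(.., Z, S X - X' S, ..),
   and among nc functions this identity characterizes j Delta f; likewise, the equations
   i Delta F_j = (j+1) Delta F_i amount to identities between values of F_i and F_j at
   commutators S X - X' S.  Writing the identity matrix as a sum of e_al e'_al with e'_al
   landing in a fixed base point Y of each domain, the difference formula expresses f through
   the F_j and its values at the base points.  Taking the latter to be 0 gives an explicit
   candidate for f, linear in the F_j, and the difference formulas for it follow from those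
   identities; intertwinings are the case S X = X' S.  When all differences vanish, the same
   reduction leaves only the values at the base points and matrix units, which give c. *)
Require Import Defs.
From Stdlib Require Import ClassicalEpsilon.
From HB Require Import structures.
From mathcomp Require Import all_boot all_order all_algebra.
Set Implicit Arguments.
Unset Strict Implicit.
Unset Printing Implicit Defensive.
Import GRing.Theory.
Local Open Scope ring_scope.

(** * Products of matrices over R and over modules *)

Section MatrixProducts.
Variables (R : comPzRingType) (V : lmodType R).

Lemma sclmx1 m n (X : 'M[V]_(m, n)) : sclmx 1 X = X.
Proof. by apply/matrixP=> i j; rewrite mxE scale1r. Qed.

Lemma sclmxA m n r q (X : 'M[V]_(m, n)) : sclmx r (sclmx q X) = sclmx (r * q) X.
Proof. by apply/matrixP=> i j; rewrite !mxE scalerA. Qed.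

Lemma sclmxD m n r (X Y : 'M[V]_(m, n)) : sclmx r (X + Y) = sclmx r X + sclmx r Y.
Proof. by apply/matrixP=> i j; rewrite !mxE scalerDr. Qed.

Lemma sclmxB m n r (X Y : 'M[V]_(m, n)) : sclmx r (X - Y) = sclmx r X - sclmx r Y.
Proof. by apply/matrixP=> i j; rewrite !mxE scalerBr. Qed.

Lemma sclNmx m n r (X : 'M[V]_(m, n)) : sclmx (- r) X = - sclmx r X.
Proof. by apply/matrixP=> i j; rewrite !mxE scaleNr. Qed.

Lemma sclmxN m n r (X : 'M[V]_(m, n)) : sclmx r (- X) = - sclmx r X.
Proof. by apply/matrixP=> i j; rewrite !mxE scalerN. Qed.

Lemma sclmx0 m n r : sclmx r (0 : 'M[V]_(m, n)) = 0.
Proof. by apply/matrixP=> i j; rewrite !mxE scaler0. Qed.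

Lemma lmulmxDl m n p (A B : 'M[R]_(m, n)) (X : 'M[V]_(n, p)) :
  lmulmx (A + B) X = lmulmx A X + lmulmx B X.
Proof.
apply/matrixP=> i l; rewrite !mxE -big_split; apply: eq_bigr => j _.
by rewrite mxE scalerDl.
Qed.

Lemma lmulmxDr m n p (A : 'M[R]_(m, n)) (X Y : 'M[V]_(n, p)) :
  lmulmx A (X + Y) = lmulmx A X + lmulmx A Y.
Proof.
apply/matrixP=> i l; rewrite !mxE -big_split; apply: eq_bigr => j _.
by rewrite mxE scalerDr.
Qed.

Lemma rmulmxDl m n p (X Y : 'M[V]_(m, n)) (A : 'M[R]_(n, p)) :
  rmulmx (X + Y) A = rmulmx X A + rmulmx Y A.
Proof.
apply/matrixP=> i l; rewrite !mxE -big_split; apply: eq_bigr => j _.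
by rewrite mxE scalerDr.
Qed.

Lemma rmulmxDr m n p (X : 'M[V]_(m, n)) (A B : 'M[R]_(n, p)) :
  rmulmx X (A + B) = rmulmx X A + rmulmx X B.
Proof.
apply/matrixP=> i l; rewrite !mxE -big_split; apply: eq_bigr => j _.
by rewrite mxE scalerDl.
Qed.

Lemma lmulmx_scl m n p (A : 'M[R]_(m, n)) r (X : 'M[V]_(n, p)) :
  lmulmx A (sclmx r X) = sclmx r (lmulmx A X).
Proof.
apply/matrixP=> i l; rewrite !mxE scaler_sumr; apply: eq_bigr => j _.
by rewrite mxE !scalerA mulrC.
Qed.

Lemma rmulmx_scl m n p r (X : 'M[V]_(m, n)) (A : 'M[R]_(n, p)) :
  rmulmx (sclmx r X) A = sclmx r (rmulmx X A).
Proof.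
apply/matrixP=> i l; rewrite !mxE scaler_sumr; apply: eq_bigr => j _.
by rewrite mxE !scalerA mulrC.
Qed.

Lemma lmulZmx m n p r (A : 'M[R]_(m, n)) (X : 'M[V]_(n, p)) :
  lmulmx (r *: A) X = sclmx r (lmulmx A X).
Proof.
apply/matrixP=> i l; rewrite !mxE scaler_sumr; apply: eq_bigr => j _.
by rewrite mxE !scalerA.
Qed.

Lemma rmulmxZ m n p (X : 'M[V]_(m, n)) r (A : 'M[R]_(n, p)) :
  rmulmx X (r *: A) = sclmx r (rmulmx X A).
Proof.
apply/matrixP=> i l; rewrite !mxE scaler_sumr; apply: eq_bigr => j _.
by rewrite mxE !scalerA.
Qed.

Lemma lmulmxA m n p q (A : 'M[R]_(m, n)) (B : 'M[R]_(n, p)) (X : 'M[V]_(p, q)) :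
  lmulmx A (lmulmx B X) = lmulmx (A *m B) X.
Proof.
apply/matrixP=> i l; rewrite !mxE.
under eq_bigr => j _ do rewrite mxE scaler_sumr.
rewrite exchange_big; apply: eq_bigr => j _; rewrite mxE scaler_suml.
by apply: eq_bigr => h _; rewrite scalerA.
Qed.

Lemma rmulmxA m n p q (X : 'M[V]_(m, n)) (A : 'M[R]_(n, p)) (B : 'M[R]_(p, q)) :
  rmulmx (rmulmx X A) B = rmulmx X (A *m B).
Proof.
apply/matrixP=> i l; rewrite !mxE.
under eq_bigr => j _ do rewrite mxE scaler_sumr.
rewrite exchange_big; apply: eq_bigr => j _; rewrite mxE scaler_suml.
by apply: eq_bigr => h _; rewrite scalerA mulrC.
Qed.

Lemma lrmulmx m n p q (A : 'M[R]_(m, n)) (X : 'M[V]_(n, p)) (B : 'M[R]_(p, q)) :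
  rmulmx (lmulmx A X) B = lmulmx A (rmulmx X B).
Proof.
apply/matrixP=> i l; rewrite !mxE.
under eq_bigr => j _ do rewrite mxE scaler_sumr.
rewrite exchange_big; apply: eq_bigr => j _; rewrite mxE scaler_sumr.
by apply: eq_bigr => h _; rewrite !scalerA mulrC.
Qed.

Lemma lmul_scalar m n r (X : 'M[V]_(m, n)) : lmulmx r%:M X = sclmx r X.
Proof.
apply/matrixP=> i l; rewrite !mxE (bigD1 i) //= big1 ?addr0 ?mxE ?eqxx //.
by move=> j /negPf ji; rewrite mxE eq_sym ji scale0r.
Qed.

Lemma rmul_scalar m n r (X : 'M[V]_(m, n)) : rmulmx X r%:M = sclmx r X.
Proof.
apply/matrixP=> i l; rewrite !mxE (bigD1 l) //= big1 ?addr0 ?mxE ?eqxx //.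
by move=> j /negPf ji; rewrite mxE ji scale0r.
Qed.

Lemma lmul1mx m n (X : 'M[V]_(m, n)) : lmulmx 1%:M X = X.
Proof. by rewrite lmul_scalar sclmx1. Qed.

Lemma rmulmx1 m n (X : 'M[V]_(m, n)) : rmulmx X 1%:M = X.
Proof. by rewrite rmul_scalar sclmx1. Qed.

Lemma lmulmx0 m n p (A : 'M[R]_(m, n)) : lmulmx A (0 : 'M[V]_(n, p)) = 0.
Proof. by apply/matrixP=> i l; rewrite !mxE big1 // => j _; rewrite mxE scaler0. Qed.

Lemma lmul0mx m n p (X : 'M[V]_(n, p)) : lmulmx (0 : 'M_(m, n)) X = 0.
Proof. by apply/matrixP=> i l; rewrite !mxE big1 // => j _; rewrite mxE scale0r. Qed.

Lemma rmulmx0 m n p (X : 'M[V]_(m, n)) : rmulmx X (0 : 'M_(n, p)) = 0.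
Proof. by apply/matrixP=> i l; rewrite !mxE big1 // => j _; rewrite mxE scale0r. Qed.

Lemma rmul0mx m n p (A : 'M[R]_(n, p)) : rmulmx (0 : 'M[V]_(m, n)) A = 0.
Proof. by apply/matrixP=> i l; rewrite !mxE big1 // => j _; rewrite mxE scaler0. Qed.

End MatrixProducts.

Section BlockProducts.
Variables (R : comPzRingType) (V : lmodType R).

Lemma lmul_col_mx m1 m2 n p (A : 'M[R]_(m1, n)) (B : 'M[R]_(m2, n)) (X : 'M[V]_(n, p)) :
  lmulmx (col_mx A B) X = col_mx (lmulmx A X) (lmulmx B X).
Proof.
apply/matrixP=> i l; rewrite mxE; case: (split_ordP i) => k ->;
  rewrite ?(col_mxEu, col_mxEd) mxE;
  by apply: eq_bigr => j _; rewrite ?(col_mxEu, col_mxEd).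
Qed.

Lemma rmul_col_mx m1 m2 n p (X : 'M[V]_(m1, n)) (Y : 'M[V]_(m2, n)) (A : 'M[R]_(n, p)) :
  rmulmx (col_mx X Y) A = col_mx (rmulmx X A) (rmulmx Y A).
Proof.
apply/matrixP=> i l; rewrite mxE; case: (split_ordP i) => k ->;
  rewrite ?(col_mxEu, col_mxEd) mxE;
  by apply: eq_bigr => j _; rewrite ?(col_mxEu, col_mxEd).
Qed.

Lemma rmul_mx_row m n p1 p2 (X : 'M[V]_(m, n)) (A : 'M[R]_(n, p1)) (B : 'M[R]_(n, p2)) :
  rmulmx X (row_mx A B) = row_mx (rmulmx X A) (rmulmx X B).
Proof.
apply/matrixP=> i l; rewrite mxE; case: (split_ordP l) => k ->;
  rewrite ?(row_mxEl, row_mxEr) mxE;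
  by apply: eq_bigr => j _; rewrite ?(row_mxEl, row_mxEr).
Qed.

Lemma rmul_row_col m n1 n2 p (X : 'M[V]_(m, n1)) (Y : 'M[V]_(m, n2))
    (A : 'M[R]_(n1, p)) (B : 'M[R]_(n2, p)) :
  rmulmx (row_mx X Y) (col_mx A B) = rmulmx X A + rmulmx Y B.
Proof.
apply/matrixP=> i l; rewrite !mxE big_split_ord; congr (_ + _);
  by apply: eq_bigr => j _; rewrite ?(row_mxEl, row_mxEr, col_mxEu, col_mxEd).
Qed.

Lemma lmul_row_col m n1 n2 p (A : 'M[R]_(m, n1)) (B : 'M[R]_(m, n2))
    (X : 'M[V]_(n1, p)) (Y : 'M[V]_(n2, p)) :
  lmulmx (row_mx A B) (col_mx X Y) = lmulmx A X + lmulmx B Y.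
Proof.
apply/matrixP=> i l; rewrite !mxE big_split_ord; congr (_ + _);
  by apply: eq_bigr => j _; rewrite ?(row_mxEl, row_mxEr, col_mxEu, col_mxEd).
Qed.

Lemma rmul_block_col m1 m2 n1 n2 p (X : 'M[V]_(m1, n1)) Z W (Y : 'M[V]_(m2, n2))
    (A : 'M[R]_(n1, p)) (B : 'M[R]_(n2, p)) :
  rmulmx (block_mx X Z W Y) (col_mx A B) =
  col_mx (rmulmx X A + rmulmx Z B) (rmulmx W A + rmulmx Y B).
Proof. by rewrite rmul_col_mx !rmul_row_col. Qed.

Lemma sclmx_row m n1 n2 r (X : 'M[V]_(m, n1)) (Y : 'M[V]_(m, n2)) :
  sclmx r (row_mx X Y) = row_mx (sclmx r X) (sclmx r Y).
Proof. exact: map_row_mx. Qed.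
End BlockProducts.

(** * Linear maps into matrices over a module *)

Section MixedLinearity.
Variables (R : comPzRingType) (W : lmodType R) (p q : nat).

(* The matrices over an R-module carry no canonical R-module structure, hence the explicit
   scaling of the source. *)
Definition linear_from (A : zmodType) (scl : R -> A -> A) (h : A -> 'M[W]_(p, q)) :=
  (forall u, scl 1 u = u) /\ forall r u v, h (scl r u + v) = sclmx r (h u) + h v.

Section Theory.
Variables (A : zmodType) (scl : R -> A -> A) (h : A -> 'M[W]_(p, q)).
Hypothesis hl : linear_from scl h.

Lemma lin_fromD u v : h (u + v) = h u + h v.
Proof. by rewrite -{1}[u](proj1 hl) (proj2 hl) sclmx1. Qed.

Lemma lin_from0 : h 0 = 0.
Proof. by apply: (addrI (h 0)); rewrite -lin_fromD !addr0. Qed.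

Lemma lin_fromN u : h (- u) = - h u.
Proof. by apply: (addrI (h u)); rewrite -lin_fromD !subrr lin_from0. Qed.

Lemma lin_fromB u v : h (u - v) = h u - h v.
Proof. by rewrite lin_fromD lin_fromN. Qed.

Lemma lin_fromZ r u : h (scl r u) = sclmx r (h u).
Proof. by rewrite -[scl r u]addr0 (proj2 hl) lin_from0 addr0. Qed.

Lemma lin_from_sum (I : finType) (F : I -> A) : h (\sum_i F i) = \sum_i h (F i).
Proof.
by elim/big_rec2: _ => [|i x y _ <-]; rewrite ?lin_from0 ?lin_fromD.
Qed.
End Theory.
End MixedLinearity.

Section LinearOperations.
Variables (R : comPzRingType) (A : zmodType) (scl : R -> A -> A).

Lemma lin_from_comp (W W' : lmodType R) p q p' q' (h : A -> 'M[W]_(p, q))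
    (g : 'M[W]_(p, q) -> 'M[W']_(p', q')) :
  linear_from (@sclmx R W p q) g -> linear_from scl h -> linear_from scl (fun u => g (h u)).
Proof. by move=> gl hl; split=> [|r u v]; rewrite ?(proj2 hl) ?(proj2 gl) //; case: hl. Qed.

Lemma lin_from_add (W : lmodType R) p q (h g : A -> 'M[W]_(p, q)) :
  linear_from scl h -> linear_from scl g -> linear_from scl (fun u => h u + g u).
Proof.
by move=> [h1 hl] [_ gl]; split=> // r u v; rewrite hl gl sclmxD addrACA.
Qed.

Lemma lin_from_sub (W : lmodType R) p q (h g : A -> 'M[W]_(p, q)) :
  linear_from scl h -> linear_from scl g -> linear_from scl (fun u => h u - g u).
Proof.
by move=> [h1 hl] [_ gl]; split=> // r u v; rewrite hl gl sclmxB opprD addrACA.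
Qed.
End LinearOperations.

Section LinearProducts.
Variables (R : comPzRingType) (V : lmodType R) (m n p : nat).

Lemma sclmx_lin r : linear_from (@sclmx R V m n) (@sclmx R V m n r).
Proof. by split=> [u|q u v]; rewrite ?sclmx1 // sclmxD !sclmxA mulrC. Qed.

Lemma lmulmx_lin (A : 'M[R]_(m, n)) :
  linear_from (@sclmx R V n p) (lmulmx A).
Proof. by split=> [u|r u v]; rewrite ?sclmx1 // lmulmxDr lmulmx_scl. Qed.

Lemma rmulmx_lin (A : 'M[R]_(n, p)) :
  linear_from (@sclmx R V m n) (fun X => rmulmx X A).
Proof. by split=> [u|r u v]; rewrite ?sclmx1 // rmulmxDl rmulmx_scl. Qed.

Lemma lmulmx_linl (X : 'M[V]_(n, p)) :
  linear_from *:%R (fun A : 'M[R]_(m, n) => lmulmx A X).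
Proof. by split=> [u|r u v]; rewrite ?scale1r // lmulmxDl lmulZmx. Qed.

Lemma rmulmx_linr (X : 'M[V]_(m, n)) :
  linear_from *:%R (fun A : 'M[R]_(n, p) => rmulmx X A).
Proof. by split=> [u|r u v]; rewrite ?scale1r // rmulmxDr rmulmxZ. Qed.
End LinearProducts.
Arguments sclmx_lin {R V m n} r.
Arguments lmulmx_lin {R V m n p} A.
Arguments rmulmx_lin {R V m n p} A.
Arguments lmulmx_linl {R V m n p} X.
Arguments rmulmx_linr {R V m n p} X.

(** * Factorization of the identity matrix through a fixed size *)

Section MatrixUnits.
Variables (R : comPzRingType) (m0 : nat).

(** The standard column e_al, padded by zero columns to width m0; [unit_row] is its transpose. Later
    m0 is the size of a base point. *)
Definition unit_col m (al : 'I_m) : 'M[R]_(m, m0) :=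
  \matrix_(i, j) ((i == al) && (j == 0 :> nat))%:R.
Definition unit_row m (al : 'I_m) : 'M[R]_(m0, m) :=
  \matrix_(i, j) ((i == 0 :> nat) && (j == al))%:R.

Lemma mul_unit_col m m' (S : 'M[R]_(m', m)) al :
  S *m unit_col al = \sum_be S be al *: unit_col be.
Proof.
apply/matrixP=> i j; rewrite mxE summxE (bigD1 al) //= big1 ?addr0; last first.
  by move=> k /negPf ka; rewrite !mxE ka mulr0.
rewrite (bigD1 i) //= big1 ?addr0; last first.
  by move=> k /negPf ki; rewrite !mxE eq_sym ki mulr0.
by rewrite !mxE !eqxx.
Qed.

Lemma mul_unit_row m m' (S : 'M[R]_(m', m)) be :
  unit_row be *m S = \sum_al S be al *: unit_row al.
Proof.
apply/matrixP=> i j; rewrite mxE summxE (bigD1 be) //= big1 ?addr0; last first.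
  by move=> k /negPf ka; rewrite !mxE ka andbF mul0r.
rewrite (bigD1 j) //= big1 ?addr0; last first.
  by move=> k /negPf ki; rewrite !mxE [j == k]eq_sym ki andbF mulr0.
by rewrite !mxE !eqxx mulrC.
Qed.

Lemma sum_unit m : (0 < m0)%N -> \sum_al unit_col al *m unit_row al = 1%:M :> 'M_m.
Proof.
move=> m0_gt0; apply/matrixP=> i j; rewrite summxE (bigD1 i) //= big1 ?addr0.
  rewrite mxE (bigD1 (Ordinal m0_gt0)) //= big1 ?addr0.
    by rewrite !mxE !eqxx mul1r eq_sym.
  by move=> k; rewrite -val_eqE /= => /negPf kn; rewrite !mxE kn andbF mul0r.
move=> k /negPf ki; rewrite mxE big1 // => l _.
by rewrite !mxE eq_sym ki mul0r.
Qed.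

Lemma sum_rmul_unit (V : lmodType R) n m (Z : 'M[V]_(n, m)) :
  (0 < m0)%N -> \sum_al rmulmx (rmulmx Z (unit_col al)) (unit_row al) = Z.
Proof.
move=> m0_gt0; under eq_bigr => al _ do rewrite rmulmxA.
by rewrite -(lin_from_sum (rmulmx_linr Z)) sum_unit ?rmulmx1.
Qed.

(** Both sides expand to the double sum of S be al times b (unit_col be) (unit_row al). *)
Lemma swap_units (W : lmodType R) p q m m' (S : 'M[R]_(m', m))
    (b : 'M[R]_(m', m0) -> 'M[R]_(m0, m) -> 'M[W]_(p, q)) :
  (forall v, linear_from *:%R (b^~ v)) -> (forall u, linear_from *:%R (b u)) ->
  \sum_al b (S *m unit_col al) (unit_row al) = \sum_be b (unit_col be) (unit_row be *m S).
Proof.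
move=> bl br; under eq_bigr => al _.
  rewrite mul_unit_col (lin_from_sum (bl _)).
  under eq_bigr => be _ do rewrite (lin_fromZ (bl _)); over.
rewrite exchange_big; apply: eq_bigr => be _.
rewrite mul_unit_row (lin_from_sum (br _)).
by apply: eq_bigr => al _; rewrite (lin_fromZ (br _)).
Qed.
End MatrixUnits.

(** * Functions with a tail of arguments *)

Section Tails.
Variables (R : comPzRingType) (N0 : lmodType R).
Local Notation T := (nctail N0).

(** Lists in [args] carry proofs that their points lie in the domains, so values elsewhere are
    ignored. *)
Definition teq a s n (G H : T a s n) := forall x, app G x = app H x.

Fixpoint tail_op (I : Type) a b (op : forall m, (I -> 'M[N0]_(a, m)) -> 'M[N0]_(b, m)) s :
    forall n, (I -> T a s n) -> T b s n :=
  match s with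
  | [::] => fun n G => op n G
  | c :: s' => fun n G m X Z => tail_op op (fun i => G i m X Z)
  end.

Lemma app_tail_op I a b (op : forall m, (I -> 'M[N0]_(a, m)) -> 'M[N0]_(b, m)) s n
    (G : I -> T a s n) x :
  app (tail_op op G) x = op _ (fun i => app (G i) x).
Proof. by elim: s n G x => [|c s IHs] n G x //=; rewrite IHs. Qed.

Lemma app_tail_map a b (phi : forall m, 'M[N0]_(a, m) -> 'M[N0]_(b, m)) s n
    (G : T a s n) x :
  app (tail_map phi G) x = phi _ (app G x).
Proof. by elim: s n G x => [|c s IHs] n G x //=; rewrite IHs. Qed.

Definition tsum (I : finType) a s n (G : I -> T a s n) : T a s n :=
  tail_op (fun m A => \sum_i A i) G.

Lemma app_tsum (I : finType) a s n (G : I -> T a s n) x :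
  app (tsum G) x = \sum_i app (G i) x.
Proof. exact: app_tail_op. Qed.

Definition tadd a s n (G H : T a s n) : T a s n :=
  tail_op (fun m A => A true + A false) (fun b => if b then G else H).

Lemma app_tadd a s n (G H : T a s n) x : app (tadd G H) x = app G x + app H x.
Proof. exact: app_tail_op. Qed.

Definition tsub a s n (G H : T a s n) : T a s n :=
  tail_op (fun m A => A true - A false) (fun b => if b then G else H).

Lemma app_tsub a s n (G H : T a s n) x : app (tsub G H) x = app G x - app H x.
Proof. exact: app_tail_op. Qed.

Definition tzero a s n : T a s n :=
  tail_op (fun m (A : void -> 'M[N0]_(a, m)) => 0) (fun v => match v with end).

Lemma app_tzero a s n x : app (tzero a s n) x = 0.
Proof. exact: app_tail_op. Qed.

(** The action of S at the last supplied point: the next matrix argument absorbs it or, if there is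
    none, it multiplies the value on the right. It turns the relation [shift_tail] into an
    equation. *)
Definition shift a s n n' (S : 'M[R]_(n', n)) : T a s n' -> T a s n :=
  match s with
  | [::] => fun G => rmulmx G S
  | c :: s' => fun G m X Z => G m X (lmulmx S Z)
  end.

Lemma shift_tailP a s n n' (S : 'M[R]_(n', n)) (G : T a s n) (G' : T a s n') :
  shift_tail S G G' <-> teq G (shift S G').
Proof.
case: s G G' => [|c s] G G' /=; first by split=> [-> // | /(_ tt)].
split=> [h [[m X pX Z] x]|h m X pX Z x]; first exact: h.
exact: (h (existT _ (Arg pX Z) x)).
Qed.

Lemma shift_shift a s n n' n'' (S : 'M[R]_(n', n)) (S' : 'M[R]_(n'', n'))
    (G : T a s n'') x :
  app (shift S (shift S' G)) x = app (shift (S' *m S) G) x.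
Proof. by case: s G x => [|c s] G x /=; rewrite ?rmulmxA ?lmulmxA. Qed.

Lemma shift1 a s n (G : T a s n) x : app (shift 1%:M G) x = app G x.
Proof. by case: s G x => [|c s] G x /=; rewrite ?rmulmx1 ?lmul1mx. Qed.

Lemma shift_teq a s n n' (S : 'M[R]_(n', n)) (G H : T a s n') :
  teq G H -> teq (shift S G) (shift S H).
Proof.
case: s G H => [|c s] G H h; first by move=> x /=; rewrite (h tt : G = H).
by case=> [[m X pX Z] x] /=; exact: (h (existT _ (Arg pX (lmulmx S Z)) x)).
Qed.

Lemma linear_tail_lin a c s n (G : T a (c :: s) n) m X (x : args s m) :
  linear_tail G -> dset (sdom c) m X ->
  linear_from (@sclmx _ _ _ _) (fun Z => app (G m X Z) x).
Proof.
by move=> lG pX; split=> [u|r u v]; [exact: sclmx1 | case: (lG m X pX) => ->].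
Qed.

Lemma linear_tail_slice a c s n (G : T a (c :: s) n) m X Z :
  linear_tail G -> dset (sdom c) m X -> linear_tail (G m X Z).
Proof. by move=> lG pX; case: (lG m X pX) => _; exact. Qed.

Lemma respects_tail_slice a c s n (G : T a (c :: s) n) m X Z :
  respects_tail G -> dset (sdom c) m X -> respects_tail (G m X Z).
Proof. by case=> _ + pX; exact. Qed.

Lemma respects_tail_head a c s n (G : T a (c :: s) n) m X m' X' (S : 'M[R]_(m', m)) Z x :
  respects_tail G -> dset (sdom c) m X -> dset (sdom c) m' X' ->
  lmulmx S X = rmulmx X' S ->
  app (G m X (rmulmx Z S)) x = app (shift S (G m' X' Z)) x.
Proof. by case=> h _ pX pX' SX; move/shift_tailP: (h _ _ _ _ _ pX pX' SX Z); exact. Qed.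

Lemma shift_lin a s n n' (G : T a s n') (x : args s n) :
  linear_tail G -> linear_from *:%R (fun S : 'M[R]_(n', n) => app (shift S G) x).
Proof.
case: s G x => [|c s] G; first by move=> x _; exact: rmulmx_linr.
case=> [[m X pX Z] x] /= lG; have hl := linear_tail_lin x lG pX.
split=> [u|r u v]; first exact: scale1r.
by rewrite lmulmxDl lmulZmx (proj2 hl).
Qed.

(** The coefficients act on the left of the values, whereas the conditions on a tail concern its
    slots; hence linearity, intertwinings and difference formulas are inherited by such
    combinations. Sums, differences, scalings and rows of a function are special cases. *)
Definition lincomb (I : finType) a b (C : I -> 'M[R]_(b, a)) s n (Gs : I -> T a s n)
    (G : T b s n) :=
  forall x, app G x = \sum_i lmulmx (C i) (app (Gs i) x).

Lemma lincomb_slice (I : finType) a b (C : I -> 'M[R]_(b, a)) c s n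
    (Gs : I -> T a (c :: s) n) G m X Z :
  lincomb C Gs G -> dset (sdom c) m X -> lincomb C (fun i => Gs i m X Z) (G m X Z).
Proof. by move=> h pX x; exact: (h (existT _ (Arg pX Z) x)). Qed.

Lemma lincomb_shift (I : finType) a b (C : I -> 'M[R]_(b, a)) s n n' (S : 'M[R]_(n', n))
    (Gs : I -> T a s n') G :
  lincomb C Gs G -> lincomb C (fun i => shift S (Gs i)) (shift S G).
Proof.
case: s Gs G => [|c s] Gs G h.
  move=> x /=; rewrite (h tt : G = _) (lin_from_sum (rmulmx_lin S)).
  by apply: eq_bigr => i _; rewrite lrmulmx.
by case=> [[m X pX Z] x] /=; exact: (h (existT _ (Arg pX (lmulmx S Z)) x)).
Qed.

Lemma lincomb_teq a s n (G H : T a s n) :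
  teq G H -> lincomb (fun _ : unit => 1%:M) (fun _ => H) G.
Proof. by move=> h x; rewrite big_const card_unit /= addr0 lmul1mx. Qed.

Lemma linear_tail_comb (I : finType) a b (C : I -> 'M[R]_(b, a)) s n
    (Gs : I -> T a s n) G :
  lincomb C Gs G -> (forall i, linear_tail (Gs i)) -> linear_tail G.
Proof.
elim: s n Gs G => [|c s IHs] n Gs G // h lGs m X pX; split; last first.
  move=> Z; apply: IHs (lincomb_slice Z h pX) _ => i; exact: linear_tail_slice.
move=> r Z Z' x; have {}h W := lincomb_slice W h pX x.
rewrite !h (lin_from_sum (sclmx_lin r)) -big_split; apply: eq_bigr => i _.
by rewrite (proj2 (linear_tail_lin x (lGs i) pX)) lmulmxDr lmulmx_scl.
Qed.

Lemma respects_tail_comb (I : finType) a b (C : I -> 'M[R]_(b, a)) s n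
    (Gs : I -> T a s n) G :
  lincomb C Gs G -> (forall i, respects_tail (Gs i)) -> respects_tail G.
Proof.
elim: s n Gs G => [|c s IHs] n Gs G // h rGs; split; last first.
  move=> m X pX Z; apply: IHs (lincomb_slice Z h pX) _ => i.
  exact: respects_tail_slice.
move=> m m' X X' S pX pX' SX Z; apply/shift_tailP => x.
rewrite (lincomb_slice _ h pX) (lincomb_shift S (lincomb_slice Z h pX')).
by apply: eq_bigr => i _; rewrite (respects_tail_head _ _ (rGs i) pX pX' SX).
Qed.

Lemma linear_tail_shift a s n n' (S : 'M[R]_(n', n)) (G : T a s n') :
  linear_tail G -> linear_tail (shift S G).
Proof.
case: s G => [|c s] G //= lG m X pX; split; last first.
  by move=> Z; exact: linear_tail_slice.
by move=> r Z Z' x; rewrite lmulmxDr lmulmx_scl (proj2 (linear_tail_lin x lG pX)).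
Qed.

Lemma respects_tail_shift a s n n' (S : 'M[R]_(n', n)) (G : T a s n') :
  respects_tail G -> respects_tail (shift S G).
Proof.
case: s G => [|c s] G //= rG; split; last first.
  by move=> m X pX Z; exact: respects_tail_slice.
move=> m m' X X' S' pX pX' SX Z; apply/shift_tailP => x.
by rewrite -lrmulmx (respects_tail_head _ _ rG pX pX' SX).
Qed.

(** * Difference formulas *)

(* [ncderiv j G H]: H is the j-th difference-differential of G, expressed by the difference
   formula G(X)(.., Z S, ..) - G(X')(.., Z, S .., ..) = H(X', X)(.., Z, S X - X' S, ..),
   which involves no choice of a scaling. *)
Fixpoint ncderiv a s : forall j n, T a s n -> T a (dupl s j) n -> Prop :=
  match s with
  | [::] => fun _ _ _ _ => True
  | c :: s' => fun j =>
    match j with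
    | 0%N => fun n G H =>
        forall m X m' X' (S : 'M[R]_(m', m)) Z x,
          dset (sdom c) m X -> dset (sdom c) m' X' ->
          app (G m X (rmulmx Z S)) x - app (shift S (G m' X' Z)) x =
          app (H m' X' Z m X (lmulmx S X - rmulmx X' S)) x
    | j'.+1 => fun n G H =>
        forall m X Z, dset (sdom c) m X -> ncderiv (G m X Z) (H m X Z)
    end
  end.

Lemma ncderiv_comb (I : finType) a b (C : I -> 'M[R]_(b, a)) s j n
    (Gs : I -> T a s n) (Hs : I -> T a (dupl s j) n) G H :
  lincomb C Gs G -> lincomb C Hs H -> (forall i, ncderiv (Gs i) (Hs i)) -> ncderiv G H.
Proof.
elim: s j n Gs G Hs H => [|c s IHs] [|j] n Gs G Hs H // hG hH d; last first.
  move=> m X Z pX; apply: IHs (lincomb_slice Z hG pX) (lincomb_slice Z hH pX) _ => i.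
  exact: (d i m X Z pX).
move=> m X m' X' S Z x pX pX'.
rewrite (lincomb_slice _ hG pX) (lincomb_shift S (lincomb_slice Z hG pX')).
rewrite (lincomb_slice (c := Slot (sdom c) (dmod (sdom c))) _ (lincomb_slice _ hH pX') pX).
rewrite -sumrB; apply: eq_bigr => i _; rewrite -(d i m X m' X' S Z x pX pX').
by rewrite (lin_fromB (lmulmx_lin _)).
Qed.

Lemma ncderiv_shift a s j n n' (S : 'M[R]_(n', n)) (G : T a s n') (H : T a (dupl s j) n') :
  ncderiv G H -> ncderiv (shift S G) (shift S H).
Proof.
case: s j G H => [|c s] [|j] G H //= d; last by move=> m X Z; exact: d.
move=> m X m' X' S' Z x pX pX'; rewrite -lrmulmx; exact: d.
Qed.

(** * Equivalence of difference formulas and difference-differential operators *)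

Fixpoint adm_slots (s : seq (slot R)) : Prop :=
  match s with
  | [::] => True
  | c :: s' => right_admissible (dset (sdom c)) /\ adm_slots s'
  end.

Lemma adm_slots_dupl s j : adm_slots s -> adm_slots (dupl s j).
Proof. by elim: s j => [|c s IHs] [|j] //= [hc hs]; split=> //; exact: IHs. Qed.

Lemma adm_scaleP (D : domain R) n m (X : 'M[dmod D]_n) (Z : 'M_(n, m)) (Y : 'M_m) :
  right_admissible (dset D) -> dset D n X -> dset D m Y ->
  let r := adm_scale (dset D) X Z Y in
  r.1 * r.2 = 1 /\ dset D (n + m)%N (block_mx X (sclmx r.1 Z) 0 Y).
Proof.
move=> hD pX pY; rewrite /adm_scale; set P := fun r => _.
apply: (epsilon_spec _ P).
by case: (hD n m X Y Z pX pY) => r [[q rq] pP]; exists (r, q).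
Qed.

Lemma lower_tailE a s n1 n2 (G : T a s (n1 + n2)) x :
  app (lower_tail G) x = app (shift (col_mx 0 1%:M) G) x.
Proof.
case: s G x => [|c s] G x /=; last by rewrite lmul_col_mx lmul0mx lmul1mx.
by rewrite -{2}[G]hsubmxK rmul_row_col rmulmx0 add0r rmulmx1.
Qed.

Lemma Delta_tail0E a c s n (G : T a (c :: s) n) m1 (X1 : 'M_m1) Z m2 (X2 : 'M_m2) W x :
  let r := adm_scale (dset (sdom c)) X1 W X2 in
  app (Delta_tail 0 G m1 X1 Z m2 X2 W) x =
  sclmx r.2 (app (shift (col_mx 0 1%:M)
                    (G _ (block_mx X1 (sclmx r.1 W) 0 X2) (row_mx Z 0))) x).
Proof. by rewrite /= app_tail_map lower_tailE. Qed.

Lemma col_mx_inl (V : lmodType R) m1 m2 n (X : 'M[V]_(m1, n)) :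
  col_mx X 0 = lmulmx (col_mx 1%:M (0 : 'M_(m2, m1))) X.
Proof. by rewrite lmul_col_mx lmul1mx lmul0mx. Qed.

Lemma block_mx_inl (V : lmodType R) m1 m2 (X : 'M[V]_m1) (W : 'M[V]_(m1, m2)) (Y : 'M[V]_m2) :
  lmulmx (col_mx 1%:M (0 : 'M_(m2, m1))) X = rmulmx (block_mx X W 0 Y) (col_mx 1%:M 0).
Proof.
by rewrite lmul_col_mx rmul_block_col !rmulmx0 rmul0mx !addr0 lmul1mx rmulmx1 lmul0mx.
Qed.

(** The corner compensates the failure of S to intertwine Y and X, so an arbitrary S yields an
    intertwining; this is the source of the difference formulas. *)
Lemma block_mx_section (V : lmodType R) m1 m2 (S : 'M[R]_(m1, m2)) (X : 'M[V]_m1) (Y : 'M[V]_m2) :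
  lmulmx (col_mx S 1%:M) Y =
  rmulmx (block_mx X (lmulmx S Y - rmulmx X S) 0 Y) (col_mx S 1%:M).
Proof.
by rewrite lmul_col_mx rmul_block_col rmul0mx add0r lmul1mx !rmulmx1 addrC subrK.
Qed.

Lemma block_mx_outr (V : lmodType R) m1 m2 (X : 'M[V]_m1) (W : 'M[V]_(m1, m2)) (Y : 'M[V]_m2) :
  lmulmx (row_mx (0 : 'M_(m2, m1)) 1%:M) (block_mx X W 0 Y) = rmulmx Y (row_mx 0 1%:M).
Proof.
by rewrite lmul_row_col lmul0mx add0r lmul1mx rmul_mx_row rmulmx0 rmulmx1.
Qed.

(** The commutator of the column [0; I] isolates the corner W, which allows values at W to be read
    off from a difference formula. *)
Lemma block_mx_defect (V : lmodType R) m1 m2 (X : 'M[V]_m1) (W : 'M[V]_(m1, m2)) (Y : 'M[V]_m2) :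
  lmulmx (col_mx (0 : 'M_(m1, m2)) 1%:M) Y - rmulmx (block_mx X W 0 Y) (col_mx 0 1%:M) =
  col_mx (- W) 0.
Proof.
rewrite lmul_col_mx rmul_block_col lmul0mx lmul1mx !rmulmx0 !add0r !rmulmx1.
by rewrite opp_col_mx add_col_mx add0r subrr.
Qed.

(** Put W = S X - X' S and P = [X' rW; 0 X]. The column [rS; I] intertwines X and P, so G at X with
    argument r Z S equals G at P with argument [Z 0], shifted by [rS; I]. Split this column and
    divide by r. *)
Lemma Delta_tail_ncderiv a s j n (G : T a s n) :
  adm_slots s -> linear_tail G -> respects_tail G -> ncderiv G (Delta_tail j G).
Proof.
elim: s j n G => [|c s IHs] [|j] n G // [hc hs] lG rG; last first.
  move=> m X Z pX; apply: IHs => //; first exact: linear_tail_slice.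
  exact: respects_tail_slice.
move=> m X m' X' S Z x pX pX'; set W := lmulmx S X - rmulmx X' S.
rewrite Delta_tail0E; set r := adm_scale _ _ _ _; set P := block_mx _ _ _ _.
have [r12 pP] : r.1 * r.2 = 1 /\ dset (sdom c) _ P by exact: adm_scaleP.
have SP : lmulmx (col_mx (r.1 *: S) 1%:M) X = rmulmx P (col_mx (r.1 *: S) 1%:M).
  rewrite /P /W sclmxB; have := block_mx_section (r.1 *: S) X' X.
  by rewrite lmulZmx rmulmxZ.
have := respects_tail_head (row_mx Z 0) x rG pX pP SP.
rewrite rmul_row_col rmul0mx addr0 rmulmxZ (lin_fromZ (linear_tail_lin x lG pX)).
(* The part [I; 0] S leads back to X', as [I; 0] intertwines X' and P; the part [0; I] is the one
   that defines [Delta_tail]. *)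
have -> : col_mx (r.1 *: S) 1%:M = r.1 *: (col_mx 1%:M 0 *m S) + col_mx 0 1%:M.
  by rewrite mul_col_mx mul1mx mul0mx scale_col_mx scaler0 add_col_mx addr0 add0r.
have hl := shift_lin x (linear_tail_slice (row_mx Z 0) lG pP).
rewrite (proj2 hl) -shift_shift.
have -> : app (shift S (shift (col_mx 1%:M 0) (G _ P (row_mx Z 0)))) x =
          app (shift S (G m' X' Z)) x.
  apply: shift_teq => y.
  rewrite -(respects_tail_head _ _ rG pX' pP (block_mx_inl _ _ _)).
  by rewrite rmul_row_col rmul0mx addr0 rmulmx1.
move=> /(congr1 (sclmx r.2)); rewrite sclmxD !sclmxA mulrC r12 !sclmx1 => ->.
by rewrite addrC addKr.
Qed.

(** Conversely, the difference formula between X2 and the block matrix P, with S = [0; I],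
    determines H. *)
Lemma ncderiv_Delta_tail a s j n (G : T a s n) (H : T a (dupl s j) n) :
  (j < size s)%N -> adm_slots s -> linear_tail G -> linear_tail H -> respects_tail H ->
  ncderiv G H -> teq (Delta_tail j G) H.
Proof.
elim: s j n G H => [|c s IHs] [|j] n G H // js [hc hs] lG lH rH d.
  case=> [[m1 X1 pX1 Z] [[m2 X2 pX2 W] x]]; rewrite -[app H _]/(app (H m1 X1 Z m2 X2 W) x).
  rewrite -[LHS]/(app (Delta_tail 0 G m1 X1 Z m2 X2 W) x) Delta_tail0E.
  set r := adm_scale _ _ _ _; set P := block_mx _ _ _ _.
  have [r12 pP] : r.1 * r.2 = 1 /\ dset (sdom c) _ P by exact: adm_scaleP.
  (* The term at X2 vanishes since [Z 0] [0; I] = 0, and the commutator is [-rW; 0]. *)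
  have := d _ X2 _ P (col_mx 0 1%:M) (row_mx Z 0) x pX2 pP.
  rewrite rmul_row_col rmulmx0 rmul0mx addr0 (lin_from0 (linear_tail_lin x lG pX2)).
  rewrite sub0r block_mx_defect -sclNmx col_mx_inl.
  (* The intertwining [I; 0] of X1 and P moves the remaining value of H from P to X1. *)
  have := @respects_tail_head a c _ n H m1 X1 _ P (col_mx 1%:M 0) (row_mx Z 0)
    (existT _ (@Arg R (Slot (sdom c) (dmod (sdom c))) m1 m2 X2 pX2 (sclmx (- r.1) W)) x)
    rH pX1 pP (block_mx_inl _ _ _).
  rewrite rmul_row_col rmul0mx addr0 rmulmx1 /= => <-.
  rewrite (lin_fromZ (@linear_tail_lin _ (Slot (sdom c) (dmod (sdom c))) s m1 _ _ X2 x
     (linear_tail_slice Z lH pX1) pX2)).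
  rewrite sclNmx => /oppr_inj ->.
  by rewrite sclmxA mulrC r12 sclmx1.
case=> [[m X pX Z] x]; apply: IHs => //; first exact: linear_tail_slice.
- exact: linear_tail_slice.
- exact: respects_tail_slice.
exact: d.
Qed.

Lemma lincomb_sub a s n (G G1 G2 : T a s n) :
  (forall x, app G x = app G1 x - app G2 x) ->
  lincomb (fun b : bool => (if b then 1 else -1)%:M) (fun b => if b then G1 else G2) G.
Proof. by move=> h x; rewrite big_bool /= !lmul_scalar sclNmx !sclmx1. Qed.

Lemma app_shift_sub a s n n' (S : 'M[R]_(n', n)) (G G1 G2 : T a s n') x :
  (forall y, app G y = app G1 y - app G2 y) ->
  app (shift S G) x = app (shift S G1) x - app (shift S G2) x.
Proof.
move=> /lincomb_sub/(lincomb_shift S) ->.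
by rewrite big_bool /= !lmul_scalar sclNmx !sclmx1.
Qed.

Lemma ncderiv_sub a s j n (G G1 G2 : T a s n) (H H1 H2 : T a (dupl s j) n) :
  (forall x, app G x = app G1 x - app G2 x) ->
  (forall x, app H x = app H1 x - app H2 x) ->
  ncderiv G1 H1 -> ncderiv G2 H2 -> ncderiv G H.
Proof.
move=> /lincomb_sub hG /lincomb_sub hH d1 d2.
apply: (ncderiv_comb (Hs := fun b => if b then H1 else H2) hG hH) => -[] //.
Qed.

Lemma ncderiv_teq a s j n (G G' : T a s n) (H H' : T a (dupl s j) n) :
  teq G' G -> teq H' H -> ncderiv G H -> ncderiv G' H'.
Proof.
by move=> /lincomb_teq hG /lincomb_teq hH d; apply: (ncderiv_comb hG hH).
Qed.

(** * Compatibility of candidates for the difference-differentials *)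

Lemma lincomb_scale a r s n (G H : T a s n) :
  (forall x, app G x = sclmx r (app H x)) -> lincomb (fun _ : unit => r%:M) (fun _ => H) G.
Proof. by move=> h x; rewrite big_const card_unit /= addr0 lmul_scalar. Qed.

(* The compatibility conditions between candidates G and H for the i-th and the j-th
   difference-differentials of one function, stated without any choice of a scaling. *)
Fixpoint compat a s : forall i j n, T a (dupl s i) n -> T a (dupl s j) n -> Prop :=
  match s with
  | [::] => fun _ _ _ _ _ => True
  | c :: s' => fun i j =>
    match i as i0, j as j0
      return forall n, T a (dupl (c :: s') i0) n -> T a (dupl (c :: s') j0) n -> Prop
    with
    | 0%N, 0%N => fun n G H =>
        forall m1 X1 m2 X2 m3 X3 (S : 'M[R]_(m1, m2)) (S' : 'M[R]_(m2, m3)) Z x,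
          dset (sdom c) m1 X1 -> dset (sdom c) m2 X2 -> dset (sdom c) m3 X3 ->
          app (H m2 X2 (rmulmx Z S) m3 X3 (lmulmx S' X3 - rmulmx X2 S')) x
          - app (H m1 X1 Z m3 X3 (lmulmx S (lmulmx S' X3 - rmulmx X2 S'))) x
          = app (G m1 X1 Z m3 X3 (rmulmx (lmulmx S X2 - rmulmx X1 S) S')) x
            - app (shift S' (G m1 X1 Z m2 X2 (lmulmx S X2 - rmulmx X1 S))) x
    | 0%N, j'.+1 => fun n G H =>
        forall m X m' X' (S : 'M[R]_(m', m)) Z,
          dset (sdom c) m X -> dset (sdom c) m' X' ->
          ncderiv (G m' X' Z m X (lmulmx S X - rmulmx X' S))
                (tsub (H m X (rmulmx Z S)) (shift S (H m' X' Z)))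
    | i'.+1, j'.+1 => fun n G H =>
        forall m X Z, dset (sdom c) m X -> compat (G m X Z) (H m X Z)
    | _, 0%N => fun _ _ _ => True
    end
  end.

Definition derivs a s n := forall j, (j < size s)%N -> T a (dupl s j) n.

Definition derivs_slice a c s n (F : derivs a (c :: s) n) m X Z : derivs a s m :=
  fun j hj => F j.+1 hj m X Z.

(** For i = j, compare the difference formulas of f for S, S' and S S'; for i < j, apply the j-th
    difference formula to both terms of the i-th one. *)
Lemma ncderiv_compat a s n (f : T a s n) (F : derivs a s n) i j
    (hi : (i < size s)%N) (hj : (j < size s)%N) :
  (forall l hl, linear_tail (F l hl)) -> (forall l hl, ncderiv f (F l hl)) -> (i <= j)%N ->
  compat (F i hi) (F j hj).
Proof.
elim: s n f F i j hi hj => [|c s IHs] n f F [|i] [|j] hi hj lF d ij //.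
- rewrite (bool_irrelevance hi hj) => m1 X1 m2 X2 m3 X3 S S' Z x pX1 pX2 pX3.
  set G := F 0%N hj; have d0 : ncderiv f G by exact: d.
  have lG : linear_tail G by exact: lF.
  rewrite -(d0 _ _ _ _ _ _ _ pX3 pX2).
  have hl := @linear_tail_lin _ (Slot (sdom c) (dmod (sdom c))) s m1 _ _ X3 x
     (linear_tail_slice Z lG pX1) pX3.
  have -> : app (shift S' (G m1 X1 Z m2 X2 (lmulmx S X2 - rmulmx X1 S))) x =
      app (shift S' (f m2 X2 (rmulmx Z S))) x - app (shift (S *m S') (f m1 X1 Z)) x.
    rewrite -shift_shift; apply: app_shift_sub => y.
    by rewrite (d0 _ _ _ _ _ _ _ pX2 pX1).
  (* The Leibniz rule for commutators. *)
  have e : lmulmx (S *m S') X3 - rmulmx X1 (S *m S') =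
    lmulmx S (lmulmx S' X3 - rmulmx X2 S') + rmulmx (lmulmx S X2 - rmulmx X1 S) S'.
    rewrite (lin_fromB (lmulmx_lin _)) (lin_fromB (rmulmx_lin _)) lmulmxA rmulmxA lrmulmx.
    by rewrite addrA subrK.
  have := d0 _ _ _ _ (S *m S') Z x pX3 pX1; rewrite e (lin_fromD hl) -rmulmxA.
  set u := app (f m3 _ _) x; set v := app (shift S' _) x.
  move=> E; apply/eqP; rewrite subr_eq [X in _ == X]addrAC.
  rewrite [_ + app (G _ _ _ _ _ (lmulmx _ _)) x]addrC.
  by rewrite -E opprB addrA subrK.
- move=> m X m' X' S Z pX pX'.
  apply: (@ncderiv_sub _ _ _ _ _ (f m X (rmulmx Z S)) (shift S (f m' X' Z))
    _ (F j.+1 hj m X (rmulmx Z S)) (shift S (F j.+1 hj m' X' Z))).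
  + by move=> x; rewrite -(d 0%N hi m X m' X').
  + by move=> x; rewrite app_tsub.
  + exact: (d j.+1 hj m X _ pX).
  + by apply: ncderiv_shift; exact: (d j.+1 hj m' X' _ pX').
move=> m X Z pX; apply: (IHs m (f m X Z) (derivs_slice F X Z) i j hi hj) => //.
  by move=> l hl; exact: (linear_tail_slice (c := c) Z (lF l.+1 hl) pX).
by move=> l hl; exact: (d l.+1 hl m X Z pX).
Qed.

Lemma shift_slice_lin a c s n n' (S : 'M[R]_(n', n)) m X (G : T a (c :: s) m) (x : args s n) :
  linear_tail G -> dset (sdom c) n' X ->
  linear_from (@sclmx _ _ _ _) (fun Z => app (shift S (G n' X Z)) x).
Proof.
move=> lG pX; split=> [u|r u v]; first exact: sclmx1.
case: s G x lG => [|d s] G x lG /=.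
  by rewrite -(proj2 (rmulmx_lin S)) -(proj2 (@linear_tail_lin a c [::] m G n' X tt lG pX)).
case: x => [[p Y pY W] x] /=.
pose y : args (d :: s) n' := existT _ (Arg pY (lmulmx S W)) x.
have [_ h] := linear_tail_lin y lG pX.
exact: (h r u v).
Qed.

(** The inductive case of [duplC] has the form of this equality, so transport along it passes the
    first slot. *)
Lemma ecast_slice a c (s s' : seq (slot R)) n (e : s = s') (G : T a (c :: s) n) m X Z :
  (ecast t (T a t n) (congr1 (cons c) e) G) m X Z = ecast t (T a t m) e (G m X Z).
Proof. by case: _ / e. Qed.

(** The differences of values of H in [compat] are values of its i-th difference-differential at
    commutators; the hypothesis replaces these by values of the one of G, for which difference
    formulas hold as well. *)
Lemma Delta_compat a s n i j (hij : (i <= j)%N) (G : T a (dupl s i) n) (H : T a (dupl s j) n) :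
  (j < size s)%N -> adm_slots s -> linear_tail G -> respects_tail G ->
  linear_tail H -> respects_tail H ->
  teq (ecast t (T a t n) (duplC s hij) (Delta_tail j.+1 G)) (Delta_tail i H) ->
  compat G H.
Proof.
elim: s n i j hij G H => [|c s IHs] n [|i] [|j] hij G H // js hs lG rG lH rH E.
- have dH := @Delta_tail_ncderiv _ _ 0 _ H (adm_slots_dupl 0 hs) lH rH.
  have dG := @Delta_tail_ncderiv _ _ 1 _ G (adm_slots_dupl 0 hs) lG rG.
  move=> m1 X1 m2 X2 m3 X3 S S' Z x pX1 pX2 pX3.
  set W := lmulmx S X2 - _; set W' := lmulmx S' X3 - _.
  pose mc := Slot (sdom c) (dmod (sdom c)).
  have -> := dH _ _ _ _ S Z (existT _ (@Arg _ mc _ _ _ pX3 W') x) pX2 pX1.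
  have -> := dG _ _ Z pX1 _ _ _ _ S' W x pX3 pX2.
  exact/esym/(E (existT _ (@Arg _ c _ _ _ pX1 Z) (existT _ (@Arg _ mc _ _ _ pX2 W)
    (existT _ (@Arg _ mc _ _ _ pX3 W') x)))).
- have dH := @Delta_tail_ncderiv _ _ 0 _ H (adm_slots_dupl j.+1 hs) lH rH.
  have dG := @Delta_tail_ncderiv _ _ j.+2 _ G (adm_slots_dupl 0 hs) lG rG.
  move=> m X m' X' S Z pX pX'; set W := lmulmx S X - _.
  have := dG _ _ Z pX' _ _ W pX.
  apply: ncderiv_teq => //.
  pose mc := Slot (sdom c) (dmod (sdom c)).
  move=> x; rewrite app_tsub (dH _ _ _ _ S Z _ pX pX').
  exact/esym/(E (existT _ (@Arg _ c _ _ _ pX' Z) (existT _ (@Arg _ mc _ _ _ pX W) x))).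
move=> m X Z pX; apply: (IHs m i j hij) => //.
- by case: hs.
- exact: (linear_tail_slice (c := c) Z lG pX).
- exact: (respects_tail_slice (c := c) Z rG pX).
- exact: (linear_tail_slice (c := c) Z lH pX).
- exact: (respects_tail_slice (c := c) Z rH pX).
move=> x; rewrite -[Delta_tail j.+1 _]/((Delta_tail j.+2 G) m X Z) -ecast_slice.
exact: (E (existT _ (Arg pX Z) x)).
Qed.

(** The matrix over R joins the copies of X2 in the two block matrices; its commutator is block
    diagonal with blocks -W and W'. *)
Lemma block_mx_transfer (V : lmodType R) m1 m2 m3 (X1 : 'M[V]_m1) (X2 : 'M[V]_m2)
    (X3 : 'M[V]_m3) (W : 'M[V]_(m1, m2)) (W' : 'M[V]_(m2, m3)) :
  lmulmx (row_mx (col_mx (0 : 'M_(m1, m2)) 1%:M) 0) (block_mx X2 W' 0 X3)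
  - rmulmx (block_mx X1 W 0 X2) (row_mx (col_mx (0 : 'M_(m1, m2)) 1%:M) (0 : 'M_(_, m3))) =
  lmulmx (col_mx 1%:M (0 : 'M_(m2, m1))) (row_mx (- W) 0)
  + rmulmx (lmulmx (col_mx (0 : 'M_(m1, m2)) 1%:M) W') (row_mx (0 : 'M_(m3, m2)) 1%:M).
Proof.
rewrite lmul_row_col lmul0mx addr0 !lmul_col_mx !lmul1mx !lmul0mx !rmul_mx_row.
rewrite rmul_block_col !rmulmx0 !rmulmx1 !add0r.
have -> : col_mx 0 (row_mx X2 W') = block_mx (0 : 'M_(m1, m2)) 0 X2 W'.
  by rewrite block_mxEv row_mx0.
have -> : row_mx (col_mx W X2) 0 = block_mx W 0 X2 (0 : 'M_(m2, m3)).
  by rewrite block_mxEh col_mx0.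
have -> : col_mx (row_mx (- W) 0) 0 = block_mx (- W) (0 : 'M_(m1, m3)) 0 (0 : 'M_(m2, m3)).
  by rewrite block_mxEv row_mx0.
have -> : row_mx 0 (col_mx 0 W') = block_mx (0 : 'M_(m1, m2)) 0 (0 : 'M_(m2, m2)) W'.
  by rewrite block_mxEh col_mx0.
by rewrite opp_block_mx !add_block_mx !oppr0 !add0r !addr0 subrr.
Qed.

(** Evaluate [compat] at the block matrices that define the operators; their intertwinings with the
    diagonal blocks reduce the terms to the two second difference-differentials. *)
Lemma compat_Delta a s n i j (hij : (i <= j)%N) (G : T a (dupl s i) n) (H : T a (dupl s j) n) :
  (j < size s)%N -> adm_slots s -> linear_tail G -> respects_tail G ->
  linear_tail H -> respects_tail H -> compat G H ->
  teq (ecast t (T a t n) (duplC s hij) (Delta_tail j.+1 G)) (Delta_tail i H).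
Proof.
elim: s n i j hij G H => [|c s IHs] n [|i] [|j] hij G H // js [hc hs] lG rG lH rH.
- move=> E; case=> [[m1 X1 pX1 Z] [[m2 X2 pX2 W1] [[m3 X3 pX3 W2] x]]].
  pose mc := Slot (sdom c) (dmod (sdom c)).
  rewrite -[LHS]/(@app _ _ a s m3
    (@Delta_tail _ _ a (mc :: s) 0 _ (G m1 X1 Z) m2 X2 W1 m3 X3 W2) x).
  rewrite Delta_tail0E.
  pose y : args (mc :: s) m2 := existT _ (@Arg _ mc _ _ _ pX3 W2) x.
  rewrite -[RHS]/(@app _ _ a (mc :: s) m2 (Delta_tail 0 H m1 X1 Z m2 X2 W1) y).
  rewrite Delta_tail0E.
  set q := adm_scale _ X2 W2 X3; set r := adm_scale _ X1 W1 X2.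
  set Q := block_mx X2 _ _ _; set P := block_mx X1 _ _ _.
  have [r12 pP] : r.1 * r.2 = 1 /\ dset (sdom c) _ P by exact: adm_scaleP.
  have [q12 pQ] : q.1 * q.2 = 1 /\ dset (sdom c) _ Q by exact: adm_scaleP.
  (* S joins the copies of X2 in P and Q, and S' includes X3 in Q. Then [Z 0] S = 0, and the
     commutators are made up of r W1 and q W2. *)
  pose S : 'M[R]_(m1 + m2, m2 + m3) := row_mx (col_mx 0 1%:M) 0.
  pose S' : 'M[R]_(m2 + m3, m3) := col_mx 0 1%:M.
  pose V := lmulmx (col_mx 0 1%:M : 'M[R]_(m1 + m2, m2)) W2.
  have lGP := linear_tail_slice (row_mx Z 0) lG pP.
  have rGP := respects_tail_slice (row_mx Z 0) rG pP.
  have := E _ P _ Q _ X3 S S' (row_mx Z 0) x pP pQ pX3.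
  have -> : rmulmx (row_mx Z 0) S = 0.
    by rewrite rmul_mx_row rmul_row_col !rmulmx0 rmul0mx addr0 row_mx0.
  have -> : app (H _ Q 0 m3 X3 (lmulmx S' X3 - rmulmx Q S')) x = 0.
    exact: (lin_from0 (linear_tail_lin
      (existT _ (@Arg _ mc _ _ _ pX3 (lmulmx S' X3 - rmulmx Q S')) x : args (mc :: s) _) lH pQ)).
  rewrite block_mx_defect.
  have -> : lmulmx S (col_mx (- sclmx q.1 W2) 0) = sclmx (- q.1) V.
    by rewrite lmul_row_col lmulmx0 addr0 -sclNmx lmulmx_scl.
  have -> : lmulmx S Q - rmulmx P S =
    lmulmx (col_mx 1%:M 0) (sclmx (- r.1) (row_mx W1 0)) + sclmx q.1 (rmulmx V (row_mx 0 1%:M)).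
    rewrite block_mx_transfer sclNmx sclmx_row sclmx0 opp_row_mx oppr0.
    by rewrite /V -rmulmx_scl -lmulmx_scl.
  have hG Y (pY : dset (sdom c) _ Y) := @linear_tail_lin a mc s _ _ _ Y x lGP pY.
  rewrite (lin_fromD (@shift_slice_lin a mc s _ _ S' _ Q _ x lGP pQ)).
  (* The part with W2 factors through [0 I], which intertwines Q and X3; it will cancel against the
     value of G at X3. *)
  have -> : app (shift S' (G _ P (row_mx Z 0) _ Q (sclmx q.1 (rmulmx V (row_mx 0 1%:M))))) x =
      app (G _ P (row_mx Z 0) _ X3 (sclmx q.1 V)) x.
    have S'K : row_mx (0 : 'M_(m3, m2)) 1%:M *m S' = 1%:M.
      by rewrite mul_row_col mul0mx mul1mx add0r.
    rewrite -rmulmx_scl -[RHS]shift1 -[in RHS]S'K.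
    rewrite -shift_shift; apply: shift_teq => z.
    exact: (@respects_tail_head a mc s _ _ _ _ _ _ _ _ z rGP pQ pX3 (block_mx_outr _ _ _)).
  have -> : app (shift S' (G _ P (row_mx Z 0) _ Q
        (lmulmx (col_mx 1%:M 0) (sclmx (- r.1) (row_mx W1 0))))) x =
      - sclmx r.1 (app (shift S' (G _ X1 Z _ Q (row_mx W1 0))) x).
    rewrite -sclNmx -(lin_fromZ (@shift_slice_lin a mc s _ _ S' _ Q _ x
      (linear_tail_slice Z lG pX1) pQ)).
    apply: shift_teq => z.
    have := @respects_tail_head a c _ n G m1 X1 _ P (col_mx 1%:M 0) (row_mx Z 0)
      (existT _ (@Arg R mc _ _ Q pQ (sclmx (- r.1) (row_mx W1 0))) z : args (mc :: s) m1)
      rG pX1 pP (block_mx_inl _ _ _).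
    by rewrite rmul_row_col rmul0mx addr0 rmulmx1 => h; exact: esym h.
  rewrite sub0r rmulmxDl lrmulmx !rmulmx_scl rmul_row_col rmul0mx addr0 rmulmx0 sclmx0.
  rewrite lmulmx0 add0r rmulmxA mul_row_col mul0mx mul1mx add0r rmulmx1.
  rewrite (lin_fromZ (@linear_tail_lin a mc s _ _ _ X3 x
    (linear_tail_slice (c := c) (row_mx Z 0) lH pP) pX3)).
  rewrite sclNmx opprK opprD opprK addrCA subrr addr0.
  (* Dividing by q r leaves 1/q on the value of G and 1/r on that of H, as in [Delta_tail]. *)
  move=> /(congr1 (sclmx (q.2 * r.2))); rewrite !sclmxA.
  rewrite -[_ * r.2 * r.1]mulrA [r.2 * r.1]mulrC r12 mulr1.
  by rewrite mulrAC [q.2 * _]mulrC q12 mul1r => <-.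
- move=> E; case=> [[m1 X1 pX1 Z] [[m2 X2 pX2 W] x]].
  pose mc := Slot (sdom c) (dmod (sdom c)).
  rewrite -[LHS]/(@app _ _ a (dupl s j) m2 (Delta_tail j (G m1 X1 Z m2 X2 W)) x).
  rewrite -[RHS]/(@app _ _ a (dupl s j) m2 (Delta_tail 0 H m1 X1 Z m2 X2 W) x).
  rewrite (@Delta_tail0E a c (dupl s j)).
  set r := adm_scale _ X1 W X2; set P := block_mx X1 _ _ _.
  have [r12 pP] : r.1 * r.2 = 1 /\ dset (sdom c) _ P by exact: adm_scaleP.
  pose S : 'M[R]_(m1 + m2, m2) := col_mx 0 1%:M.
  (* L is the 0-th difference-differential of H at X1, X2 and W; it suffices to show that L
     satisfies the j-th difference formula for G at these arguments. *)
  pose K := shift S (H _ P (row_mx Z 0)).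
  pose L := tail_map (fun m Y => sclmx r.2 Y) K.
  have hL y : app L y = sclmx r.2 (app K y) by rewrite app_tail_map.
  rewrite -hL.
  have := E _ X2 _ P S (row_mx Z 0) pX2 pP.
  rewrite /S rmul_row_col rmulmx0 rmul0mx addr0 block_mx_defect => d.
  have lK : linear_tail K.
    by apply: linear_tail_shift; exact: (linear_tail_slice (c := c) _ lH pP).
  have rK : respects_tail K.
    by apply: respects_tail_shift; exact: (respects_tail_slice (c := c) _ rH pP).
  apply: (@ncderiv_Delta_tail a s j m2 (G m1 X1 Z m2 X2 W) L) => //.
  + have lGX := linear_tail_slice (c := c) Z lG pX1.
    exact: (@linear_tail_slice a mc s _ _ _ X2 W lGX pX2).
  + exact: linear_tail_comb (lincomb_scale hL) (fun=> lK).
  + exact: respects_tail_comb (lincomb_scale hL) (fun=> rK).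
  apply: (ncderiv_comb (C := fun _ : unit => (- r.2)%:M) _ _ (fun=> d)) => y;
    rewrite big_const card_unit /= addr0 lmul_scalar.
  + have hl := @linear_tail_lin a mc s _ _ _ X2 y (linear_tail_slice Z lG pX1) pX2.
    have hW : W = sclmx (- r.2) (- sclmx r.1 W).
      by rewrite -sclNmx sclmxA mulrNN mulrC r12 sclmx1.
    rewrite {1}hW (lin_fromZ hl); congr (sclmx _ _).
    have := @respects_tail_head a c _ n G m1 X1 _ P (col_mx 1%:M 0) (row_mx Z 0)
      (existT _ (@Arg R mc _ _ X2 pX2 (- sclmx r.1 W)) y : args (mc :: s) m1)
      rG pX1 pP (block_mx_inl _ _ _).
    by rewrite rmul_row_col rmul0mx addr0 rmulmx1 /= col_mx_inl.
  rewrite hL app_tsub (lin_from0 (@linear_tail_lin a c (dupl s j) _ _ _ X2 y lH pX2)).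
  by rewrite sub0r sclNmx sclmxN opprK.
move=> E; case=> [[m X pX Z] x].
rewrite -[LHS]/(app ((ecast t (T a t n) (congr1 (cons c) (duplC s (hij : (i <= j)%N)))
  (Delta_tail j.+2 G)) m X Z) x) ecast_slice.
apply: (IHs m i j hij) => //.
- exact: (linear_tail_slice (c := c) Z lG pX).
- exact: (respects_tail_slice (c := c) Z rG pX).
- exact: (linear_tail_slice (c := c) Z lH pX).
- exact: (respects_tail_slice (c := c) Z rH pX).
exact: E.
Qed.

(** * Integration *)

Fixpoint pos_slots (s : seq (slot R)) : Prop :=
  match s with
  | [::] => True
  | c :: s' => (forall m X, dset (sdom c) m X -> (0 < m)%N) /\ pos_slots s'
  end.

(** The matrix of size 0 is a mere default for the choice. *)
Definition base_point (D : domain R) : {m & 'M[dmod D]_m} :=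
  epsilon (inhabits (existT (fun m => 'M[dmod D]_m) 0%N 0))
    (fun Y => dset D (tag Y) (tagged Y)).

Lemma base_pointP (D : domain R) m (X : 'M[dmod D]_m) :
  dset D m X -> dset D (tag (base_point D)) (tagged (base_point D)).
Proof.
move=> pX; apply: (epsilon_spec _ (fun Y => dset D (tag Y) (tagged Y))).
by exists (existT (fun k => 'M[dmod D]_k) m X).
Qed.

(* Since the identity is the sum of [unit_col al *m unit_row al], the difference formulas for
   T = unit_row al move every point to a fixed base point, at the cost of the terms below.
   The part of the integral that lives at the base points only can be taken to be 0. *)
Fixpoint integral a s : forall n, derivs a s n -> T a s n :=
  match s with
  | [::] => fun n _ => tzero a [::] n
  | c :: s' => fun n F m X Z =>
      let m0 := tag (base_point (sdom c)) in
      let Y := tagged (base_point (sdom c)) in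
      tsum (fun al : 'I_m =>
        let W := rmulmx Z (unit_col R m0 al) in
        let S := unit_row R m0 al in
        tadd (F 0%N isT m0 Y W m X (lmulmx S X - rmulmx Y S))
             (shift S (integral (derivs_slice F Y W))))
  end.

(** Linearity of the integral in the candidates F; through slices it gives linearity in the matrix
    arguments. *)
Lemma integral_comb (I : finType) a b (C : I -> 'M[R]_(b, a)) s n
    (Fs : I -> derivs a s n) (F : derivs b s n) :
  (forall j hj, lincomb C (fun i => Fs i j hj) (F j hj)) ->
  lincomb C (fun i => integral (Fs i)) (integral F).
Proof.
elim: s n Fs F => [|c s IHs] n Fs F hF.
  by move=> x; rewrite app_tzero big1 // => i _; rewrite app_tzero lmulmx0.
case=> [[m X pX Z] x].
have pY := base_pointP pX; set m0 := tag _ in pY; set Y := tagged _ in pY.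
rewrite -[LHS]/(app (integral F m X Z) x) /= app_tsum.
under [RHS]eq_bigr => i _ do rewrite app_tsum (lin_from_sum (lmulmx_lin _)).
rewrite exchange_big; apply: eq_bigr => al _ /=.
rewrite app_tadd -/m0 -/Y.
set W := rmulmx _ _; set D := _ - _.
under [RHS]eq_bigr => i _ do rewrite app_tadd lmulmxDr.
rewrite big_split; congr (_ + _).
  pose mc := Slot (sdom c) (dmod (sdom c)).
  exact: (hF 0%N isT (existT _ (Arg pY W) (existT _ (@Arg R mc _ _ X pX D) x))).
apply: lincomb_shift; apply: IHs => j hj z.
exact: (hF j.+1 hj (existT _ (Arg pY W) z)).
Qed.

Lemma lincomb_tsum (I : finType) a s n (G : I -> T a s n) :
  lincomb (fun _ => 1%:M) G (tsum G).
Proof. by move=> x; rewrite app_tsum; apply: eq_bigr => i _; rewrite lmul1mx. Qed.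

Lemma lincomb_tadd a s n (G H : T a s n) :
  lincomb (fun _ : bool => 1%:M) (fun b => if b then G else H) (tadd G H).
Proof. by move=> x; rewrite app_tadd big_bool /= !lmul1mx. Qed.

Lemma linear_tail_lin1 a c d s n (G : T a (c :: d :: s) n) m X m' X' Z' (x : args s m') :
  linear_tail G -> dset (sdom c) m X -> dset (sdom d) m' X' ->
  linear_from (@sclmx _ _ _ _) (fun Z => app (G m X Z m' X' Z') x).
Proof.
move=> lG pX pX'; split=> [u|r u v]; first exact: sclmx1.
pose y : args (d :: s) m := existT _ (Arg pX' Z') x.
by have [_ h] := linear_tail_lin y lG pX; exact: (h r u v).
Qed.

Lemma linear_tail_lin2 a c d s n (G : T a (c :: d :: s) n) m X m' X' Z (x : args s m') :
  linear_tail G -> dset (sdom c) m X -> dset (sdom d) m' X' ->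
  linear_from (@sclmx _ _ _ _) (fun Z' => app (G m X Z m' X' Z') x).
Proof. by move=> lG pX; apply: linear_tail_lin; exact: linear_tail_slice. Qed.

Lemma integral_slice_comb a c s n m0 Y (F : derivs a (c :: s) n) r u v :
  (forall j hj, linear_tail (F j hj)) -> dset (sdom c) m0 Y ->
  lincomb (fun b : bool => (if b then r else 1)%:M)
    (fun b => integral (derivs_slice F Y (if b then u else v)))
    (integral (derivs_slice F Y (sclmx r u + v))).
Proof.
move=> lF pY; apply: integral_comb => j hj z; rewrite big_bool /= !lmul_scalar sclmx1.
exact: (proj2 (@linear_tail_lin a c _ n _ _ _ z (lF j.+1 hj) pY)).
Qed.

Lemma shift_integral_lin a c s n m0 Y n' (S : 'M[R]_(m0, n')) (F : derivs a (c :: s) n) x :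
  (forall j hj, linear_tail (F j hj)) -> dset (sdom c) m0 Y ->
  linear_from (@sclmx _ _ _ _) (fun W => app (shift S (integral (derivs_slice F Y W))) x).
Proof.
move=> lF pY; split=> [u|r u v]; first exact: sclmx1.
rewrite (lincomb_shift S (integral_slice_comb r u v lF pY)).
by rewrite big_bool /= !lmul_scalar sclmx1.
Qed.

Lemma linear_integral a s n (F : derivs a s n) :
  (forall j hj, linear_tail (F j hj)) -> linear_tail (integral F).
Proof.
elim: s n F => [|c s IHs] n F lF // m X pX.
have pY := base_pointP pX; pose mc := Slot (sdom c) (dmod (sdom c)).
split=> [r Z Z' x|Z] /=.
  rewrite !app_tsum (lin_from_sum (sclmx_lin r)) -big_split; apply: eq_bigr => al _ /=.
  rewrite !app_tadd rmulmxDl rmulmx_scl (proj2 (shift_integral_lin _ _ lF pY)).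
  rewrite (proj2 (@linear_tail_lin1 a c mc s n _ _ _ _ _ _ x (lF 0%N isT) pY pX)).
  by rewrite sclmxD addrACA.
apply: linear_tail_comb (lincomb_tsum _) _ => al.
apply: linear_tail_comb (lincomb_tadd _ _) _ => -[].
  have lFY := linear_tail_slice (c := c) _ (lF 0%N isT) pY.
  exact: (@linear_tail_slice a mc s _ _ _ X _ (lFY _) pX).
apply: linear_tail_shift; apply: IHs => j hj.
exact: (linear_tail_slice (c := c) _ (lF j.+1 hj) pY).
Qed.

Lemma app_shift_sum (I : finType) a s n n' (S : 'M[R]_(n', n)) (G : T a s n') Gs x :
  (forall y, app G y = \sum_(i : I) app (Gs i) y) ->
  app (shift S G) x = \sum_i app (shift S (Gs i)) x.
Proof.
move=> h; have {}h : lincomb (fun _ => 1%:M) Gs G.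
  by move=> y; rewrite h; apply: eq_bigr => i _; rewrite lmul1mx.
by rewrite (lincomb_shift S h); apply: eq_bigr => i _; rewrite lmul1mx.
Qed.

Lemma app_shift_add a s n n' (S : 'M[R]_(n', n)) (G H : T a s n') x :
  app (shift S (tadd G H)) x = app (shift S G) x + app (shift S H) x.
Proof.
rewrite (@app_shift_sum bool _ _ _ _ S _ (fun b => if b then G else H)) ?big_bool //.
by move=> y; rewrite app_tadd big_bool.
Qed.

Lemma ncderiv_add a s j n (G G1 G2 : T a s n) (H H1 H2 : T a (dupl s j) n) :
  (forall x, app G x = app G1 x + app G2 x) ->
  ncderiv G1 H1 -> ncderiv G2 H2 ->
  (forall x, app H x = app H1 x + app H2 x) -> ncderiv G H.
Proof.
move=> hG d1 d2 hH.
apply: (ncderiv_comb (C := fun _ : bool => 1%:M) (Gs := fun b => if b then G1 else G2)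
  (Hs := fun b => if b then H1 else H2)) => [x|x|[]] //.
  by rewrite hG big_bool /= !lmul1mx.
by rewrite hH big_bool /= !lmul1mx.
Qed.

(** For j = 0, moving S across the matrix units makes the integrals at the base point cancel, and
    compatibility of F_0 with itself evaluates the rest. For later slots, each summand is handled by
    compatibility with F_0 and induction. *)
Lemma ncderiv_integral a s n (F : derivs a s n) j (hj : (j < size s)%N) :
  pos_slots s -> (forall l hl, linear_tail (F l hl)) ->
  (forall i l hi hl, (i <= l)%N -> compat (F i hi) (F l hl)) ->
  ncderiv (integral F) (F j hj).
Proof.
elim: s n F j hj => [|c s IHs] n F [|j] hj // [hc hs] lF cF.
  pose mc := Slot (sdom c) (dmod (sdom c)).
  move=> m X m' X' S Z x pX pX'; rewrite (bool_irrelevance hj isT).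
  have {}pY := base_pointP pX.
  rewrite -[integral F m X _]/(@integral a (c :: s) n F m X (rmulmx Z S)) /=.
  rewrite app_tsum (app_shift_sum S x (app_tsum _)).
  move: pY; set m0 := tag _; set Y := tagged _ => pY.
  have m0_gt0 := hc _ _ pY.
  (* A summand of the integral at X, as a bilinear function of W and V; there W is the matrix
     argument times e_al and V = e'_al. *)
  pose b W V := app (F 0%N isT m0 Y W m X (lmulmx V X - rmulmx Y V)) x
    + app (shift V (integral (derivs_slice F Y W))) x.
  have bl V : linear_from (@sclmx _ _ _ _) (b^~ V).
    apply: lin_from_add; last exact: shift_integral_lin.
    exact: (@linear_tail_lin1 a c mc s n _ _ _ _ _ _ x (lF 0%N isT) pY pX).
  have br W : linear_from *:%R (b W).
    apply: lin_from_add.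
      apply: lin_from_comp (@linear_tail_lin2 a c mc s n _ _ _ _ _ W x (lF 0%N isT) pY pX) _.
      exact: lin_from_sub (lmulmx_linl X) (rmulmx_linr Y).
    apply: shift_lin; apply: linear_integral => j hj'.
    exact: (linear_tail_slice (c := c) _ (lF j.+1 hj') pY).
  under eq_bigr => al _ do rewrite app_tadd rmulmxA -[_ + _]/(b (rmulmx Z _) _).
  (* The pair Z S e_al, e'_al is traded for Z e_be, e'_be S. *)
  rewrite (@swap_units _ _ _ _ _ _ _ S (fun U V => b (rmulmx Z U) V)) //; last first.
    by move=> V; exact: lin_from_comp (bl V) (rmulmx_linr Z).
  rewrite -sumrB; set D := lmulmx S X - _.
  rewrite -[in RHS](sum_rmul_unit Z m0_gt0).
  rewrite (lin_from_sum (@linear_tail_lin1 a c mc s n _ _ _ _ _ D x (lF 0%N isT) pX' pX)).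
  apply: eq_bigr => be _; rewrite app_shift_add shift_shift.
  set V := unit_row R m0 be; set W := rmulmx Z _.
  rewrite /b opprD addrACA subrr addr0.
  have hl := @linear_tail_lin2 a c mc s n _ _ _ _ _ W x (lF 0%N isT) pY pX.
  have -> : lmulmx (V *m S) X - rmulmx Y (V *m S) =
      lmulmx V D + rmulmx (lmulmx V X' - rmulmx Y V) S.
    rewrite /D (lin_fromB (lmulmx_lin _)) (lin_fromB (rmulmx_lin _)) lmulmxA rmulmxA lrmulmx.
    by rewrite addrA subrK.
  (* Compatibility along the chain Y, X', X leaves the value of F at X', X and D, with matrix
     argument Z e_be e'_be. *)
  have E := cF 0%N 0%N isT isT isT _ Y _ X' _ X V S W x pY pX' pX.
  by rewrite (lin_fromD hl) -addrA -E addrC subrK.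
move=> m X Z pX; have pY := base_pointP pX.
have m0_gt0 := hc _ _ pY.
pose u := unit_col R (tag (base_point (sdom c))).
pose v := unit_row R (tag (base_point (sdom c))).
apply: (ncderiv_comb (Hs := fun al : 'I_m => F j.+1 hj m X (rmulmx (rmulmx Z (u m al)) (v m al)))
  (lincomb_tsum _)) => [x|al].
  under eq_bigr => al _ do rewrite lmul1mx.
  rewrite -(lin_from_sum (linear_tail_lin x (lF j.+1 hj) pX)).
  by rewrite (sum_rmul_unit Z m0_gt0).
(* The first summand has as derivative a value of F at X minus a shifted value at Y, by
   compatibility; the second contributes that shifted value at Y, by induction. *)
apply: ncderiv_add.
- by move=> x; exact: app_tadd.
- exact: (cF 0%N j.+1 isT hj isT m X _ _ (v m al) (rmulmx Z (u m al)) pX pY).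
- apply: ncderiv_shift; apply: (IHs _ (derivs_slice F _ _) j hj) => // [l hl|i l hi hl il].
    exact: (linear_tail_slice (c := c) _ (lF l.+1 hl) pY).
  exact: (cF i.+1 l.+1 hi hl il _ _ _ pY).
by move=> x; rewrite app_tsub subrK.
Qed.

(** For an intertwining the commutator is 0, and F vanishes there by linearity in the inserted
    argument. *)
Lemma ncderiv_respects a s n (f : T a s n) (F : derivs a s n) :
  (forall j hj, linear_tail (F j hj)) -> (forall j hj, ncderiv f (F j hj)) ->
  respects_tail f.
Proof.
elim: s n f F => [|c s IHs] n f F lF d //; split; last first.
  move=> m X pX Z; apply: (IHs m (f m X Z) (derivs_slice F X Z)) => j hj.
    exact: (linear_tail_slice (c := c) Z (lF j.+1 hj) pX).
  exact: (d j.+1 hj m X Z pX).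
move=> m m' X X' S pX pX' SX Z; apply/shift_tailP => x; apply/eqP.
have lX' := linear_tail_slice (c := c) Z (lF 0%N isT) pX'.
rewrite -subr_eq0 (d 0%N isT m X m' X' S Z x pX pX') SX subrr; apply/eqP.
exact: (lin_from0 (@linear_tail_lin a (Slot (sdom c) (dmod (sdom c))) s _ _ _ X x lX' pX)).
Qed.

(** * Functions without differences *)

(* All difference-differentials of g vanish. *)
Fixpoint flat a s : forall n, T a s n -> Prop :=
  match s with
  | [::] => fun _ _ => True
  | c :: s' => fun n g =>
      (forall m X m' X' (S : 'M[R]_(m', m)) Z x,
         dset (sdom c) m X -> dset (sdom c) m' X' ->
         app (g m X (rmulmx Z S)) x = app (shift S (g m' X' Z)) x) /\
      (forall m X Z, dset (sdom c) m X -> flat (g m X Z))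
  end.

Lemma ncderiv_flat a s n (f f' g : T a s n) (F : derivs a s n) :
  (forall j hj, ncderiv f (F j hj)) -> (forall j hj, ncderiv f' (F j hj)) ->
  (forall x, app g x = app f' x - app f x) -> flat g.
Proof.
elim: s n f f' g F => [|c s IHs] n f f' g F d d' hg //; split; last first.
  move=> m X Z pX; apply: (IHs m (f m X Z) (f' m X Z) _ (derivs_slice F X Z)).
  - by move=> j hj; exact: (d j.+1 hj m X Z pX).
  - by move=> j hj; exact: (d' j.+1 hj m X Z pX).
  by move=> x; exact: (hg (existT _ (Arg pX Z) x)).
move=> m X m' X' S Z x pX pX'.
have {}hg k Y W : dset (sdom c) k Y -> forall y,
    app (g k Y W) y = app (f' k Y W) y - app (f k Y W) y.
  by move=> pY y; exact: (hg (existT _ (Arg pY W) y)).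
rewrite (app_shift_sub S x (hg _ _ Z pX')).
rewrite (hg _ _ _ pX).
have := d 0%N isT m X m' X' S Z x pX pX'.
rewrite -(d' 0%N isT m X m' X' S Z x pX pX').
set u := app _ x; set v := app _ x; set u' := app _ x; set v' := app _ x => E.
by rewrite -[u'](subrK v') -E addrAC [u - v]addrC addrK addrC.
Qed.

Definition corner (V : lmodType R) n m (z : V) : 'M[V]_(n, m) :=
  \matrix_(i, j) if (i == 0 :> nat) && (j == 0 :> nat) then z else 0.

Lemma corner_lin (V : lmodType R) n m r (u v : V) :
  corner n m (r *: u + v) = sclmx r (corner n m u) + corner n m v.
Proof.
by apply/matrixP => i j; rewrite !mxE; case: ifP => _ //; rewrite scaler0 addr0.
Qed.

(** Each entry of row al is put into a corner of width m0 and carried to its column by a unit row,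
    which flatness then trades for a passage to the base point. *)
Lemma lmul_unit_row (V : lmodType R) n0 m0 n m (Z : 'M[V]_(n, m)) al : (0 < m0)%N ->
  lmulmx (unit_row R n0 al) Z =
  \sum_be rmulmx (corner n0 m0 (Z al be)) (unit_row R m0 be).
Proof.
move=> m0_gt0; apply/matrixP=> i l; rewrite mxE summxE.
rewrite (bigD1 al) //= big1 ?addr0; last first.
  by move=> k /negPf ka; rewrite !mxE ka andbF scale0r.
rewrite (bigD1 l) //= big1 ?addr0; last first.
  move=> k /negPf kl; rewrite mxE big1 // => j _.
  by rewrite !mxE [l == k]eq_sym kl andbF scale0r.
rewrite !mxE eqxx andbT (bigD1 (Ordinal m0_gt0)) //= big1 ?addr0; last first.
  by move=> k; rewrite -val_eqE /= => /negPf k0; rewrite !mxE k0 scale0r.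
by rewrite !mxE !eqxx !andbT scale1r; case: ifP => _; rewrite ?scale1r ?scale0r.
Qed.

(* The (0, 0) entry of the value of g at the base points and the matrices whose only nonzero
   entry is a (0, 0) entry; 0 if some domain is empty. *)
Fixpoint coef s : forall n, T 1 s n -> vals s -> N0 :=
  match s with
  | [::] => fun n (g : 'M_(1, n)) _ => \sum_(j < n | j == 0 :> nat) g 0 j
  | c :: s' => fun n g w =>
      let m0 := tag (base_point (sdom c)) in
      let Y := tagged (base_point (sdom c)) in
      if excluded_middle_informative (dset (sdom c) m0 Y)
      then coef (g m0 Y (corner n m0 w.1)) w.2 else 0
  end.

Lemma coef_comb s n (g g1 g2 : T 1 s n) r w :
  (forall x, app g x = sclmx r (app g1 x) + app g2 x) ->
  coef g w = r *: coef g1 w + coef g2 w.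
Proof.
elim: s n g g1 g2 w => [|c s IHs] n g g1 g2 w hg /=.
  rewrite scaler_sumr -big_split; apply: eq_bigr => j _.
  by rewrite (hg tt : g = _) !mxE.
case: excluded_middle_informative => pY; last by rewrite scaler0 addr0.
by apply: IHs => x; exact: (hg (existT _ (Arg pY _) x)).
Qed.

Lemma klinear0 s : klinear (fun _ : vals s => 0 : N0).
Proof. by elim: s => [|c s IHs] //=; split=> // r u v w; rewrite scaler0 addr0. Qed.

Lemma klinear_coef s n (g : T 1 s n) : linear_tail g -> klinear (coef g).
Proof.
elim: s n g => [|c s IHs] n g lg //=; split=> [r u v w|u];
  case: excluded_middle_informative => pY.
- apply: coef_comb => x; rewrite corner_lin; exact: (proj2 (linear_tail_lin x lg pY)).
- by rewrite scaler0 addr0.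
- by apply: IHs; exact: linear_tail_slice.
exact: klinear0.
Qed.

(** The diagonal convention for an empty list makes the recursion uniform, the last slot
    included. *)
Lemma path_sum_cons (c : slot R) s (k : vals (c :: s) -> N0) n (x : args (c :: s) n) al om :
  path_sum k x al om =
  \sum_be path_sum (fun w => k (amat (projT1 x) al be, w)) (projT2 x) be om.
Proof.
case: s k x om => [|d s] k x om //=.
by rewrite -big_mkcond big_pred1_eq.
Qed.

(** At each slot, flatness replaces the point by the base point and hands a unit row be on to the
    next slot; be is the next index of the path. *)
Lemma coefP s n (g : T 1 s n) m (x : args s m) (al : 'I_m) om :
  pos_slots s -> (0 < n)%N -> linear_tail g -> flat g ->
  app (shift (unit_row R n al) g) x 0 om = path_sum (coef g) x al om.
Proof.
elim: s n g m x al om => [|c s IHs] n g m x al om; first move=> _ n_gt0 _ _.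
  rewrite /= mxE (bigD1 (Ordinal n_gt0)) //= big1 ?addr0; last first.
    by move=> k; rewrite -val_eqE /= => /negPf k0; rewrite mxE k0 scale0r.
  rewrite mxE (big_pred1 (Ordinal n_gt0)) //= [om == al]eq_sym.
  by case: eqP => _; rewrite ?scale1r ?scale0r.
move=> [hc hs] n_gt0 lg [fg fgs]; case: x om => [[k X pX Z] x] om.
have pY := base_pointP pX; have m0_gt0 := hc _ _ pY.
rewrite path_sum_cons -[app _ _]/(app (g k X (lmulmx (unit_row R n al) Z)) x).
rewrite (lmul_unit_row _ _ _ m0_gt0) (lin_from_sum (linear_tail_lin x lg pX)) summxE.
apply: eq_bigr => be _; rewrite (fg _ _ _ _ _ _ _ pX pY) IHs //; last first.
- exact: fgs.
- exact: linear_tail_slice.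
by rewrite /=; case: excluded_middle_informative => // npY.
Qed.
End Tails.

(** * The first point as the point of a slot *)

Section ScalarSlot.
Variables (R : comPzRingType) (N0 : lmodType R).

Lemma sclmx_regular m n r (Z : 'M[R^o]_(m, n)) : sclmx r Z = r *: (Z : 'M[R]_(m, n)).
Proof. by apply/matrixP=> i j; rewrite !mxE. Qed.

Lemma rmulmx_regular m n p (Z : 'M[R^o]_(m, n)) (S : 'M[R]_(n, p)) :
  rmulmx Z S = (Z : 'M[R]_(m, n)) *m S.
Proof. by apply/matrixP=> i j; rewrite !mxE; apply: eq_bigr => l _; rewrite mulrC. Qed.

Lemma lmul_delta n m (A : 'M[N0]_(n, m)) al om :
  lmulmx (delta_mx 0 al : 'M_(1, n)) A 0 om = A al om.
Proof.
rewrite mxE (bigD1 al) //= big1 ?addr0; last first.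
  by move=> k /negPf ka; rewrite !mxE ka andbF scale0r.
by rewrite !mxE !eqxx scale1r.
Qed.

Lemma eq_lmulmx n m (A B : 'M[N0]_(n, m)) :
  (forall Z : 'rV[R]_n, lmulmx Z A = lmulmx Z B) -> A = B.
Proof. by move=> h; apply/matrixP=> al om; rewrite -(lmul_delta A) -(lmul_delta B) h. Qed.

Lemma lincomb_lmul a b s n (Z : 'M[R]_(b, a)) (G : nctail N0 a s n) :
  lincomb (fun _ : unit => Z) (fun _ => G) (tail_map (fun p Y => lmulmx Z Y) G).
Proof. by move=> x; rewrite app_tail_map big_const card_unit /= addr0. Qed.

Lemma shift_lmul a b s n n' (S : 'M[R]_(n', n)) (Z : 'M[R]_(b, a)) (G : nctail N0 a s n') x :
  app (shift S (tail_map (fun p Y => lmulmx Z Y) G)) x = lmulmx Z (app (shift S G) x).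
Proof. by rewrite (lincomb_shift S (lincomb_lmul Z G)) big_const card_unit /= addr0. Qed.

Lemma Delta_tail_lmul a b s j n (Z : 'M[R]_(b, a)) (G : nctail N0 a s n) x :
  app (Delta_tail j (tail_map (fun p Y => lmulmx Z Y) G)) x =
  lmulmx Z (app (Delta_tail j G) x).
Proof.
elim: s j n G x => [|c s IHs] [|j] n G x //.
  case: x => [[m1 X1 pX1 Z1] [[m2 X2 pX2 W] x]].
  pose TZ := tail_map (fun p Y => lmulmx Z Y) G.
  rewrite -[LHS]/(app (Delta_tail 0 TZ m1 X1 Z1 m2 X2 W) x).
  rewrite -[app (Delta_tail 0 G) _]/(app (Delta_tail 0 G m1 X1 Z1 m2 X2 W) x).
  by rewrite !Delta_tail0E /= shift_lmul lmulmx_scl.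
by case: x => [[m X pX W] x]; exact: IHs.
Qed.

Variable P : domain R.

(* A function of order k with points in P and slots s is seen as a function f' of order
   k + 1 with f'(X^0, ...)(Z, Z^1, ...) = Z f(X^0, ...)(Z^1, ...), Z a row over R; then all the
   points are points of slots. *)
Definition rslot : slot R := Slot P R^o.

Definition tail_of s (f : ncfun P N0 s) : nctail N0 1 (rslot :: s) 1 :=
  fun m X Z => tail_map (fun p Y => lmulmx (Z : 'M[R]_(1, m)) Y) (f m X).
Arguments tail_of {s} f m X Z.

(** Standard rows as scalar arguments recover the rows of the value. *)
Definition of_tail s (G : nctail N0 1 (rslot :: s) 1) : ncfun P N0 s :=
  fun m X => tail_op (fun p (A : 'I_m -> 'M[N0]_(1, p)) => \matrix_(i, j) A i 0 j)
    (fun i => G m X (delta_mx 0 i)).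
Arguments of_tail {s} G n X.

Lemma app_tail_of s (f : ncfun P N0 s) m X Z x :
  app (tail_of f m X Z) x = lmulmx (Z : 'M[R]_(1, m)) (app (f m X) x).
Proof. exact: app_tail_map. Qed.

Lemma of_tailK s (G : nctail N0 1 (rslot :: s) 1) :
  linear_tail G -> teq (tail_of (of_tail G)) G.
Proof.
move=> lG [[m X pX Z] x].
rewrite -[RHS]/(app (G m X Z) x) -[LHS]/(app (tail_of (of_tail G) m X Z) x).
rewrite app_tail_of app_tail_op.
have hZ : Z = \sum_i sclmx ((Z : 'M[R]_(1, m)) 0 i) (delta_mx 0 i : 'M[R^o]_(1, m)).
  by rewrite [LHS]row_sum_delta; apply: eq_bigr => i _; rewrite sclmx_regular.
have hl := linear_tail_lin x lG pX.
rewrite [in RHS]hZ (lin_from_sum hl); apply/matrixP=> i l; rewrite ord1 mxE summxE.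
by apply: eq_bigr => j _; rewrite (lin_fromZ hl) !mxE.
Qed.

Lemma nceq_tail_of s (f g : ncfun P N0 s) : nceq f g <-> teq (tail_of f) (tail_of g).
Proof.
split=> [h [[m X pX Z] x]|h m X pX x].
  rewrite -[LHS]/(app (tail_of f m X Z) x) -[RHS]/(app (tail_of g m X Z) x).
  by rewrite !app_tail_of h.
apply: eq_lmulmx => Z; rewrite -!app_tail_of.
exact: (h (existT _ (@Arg R rslot 1 m X pX Z) x)).
Qed.

(** Condition (i), multiplied on the left by an arbitrary row Z, is the intertwining condition at
    the scalar slot. *)
Lemma is_nc_tail_of s (f : ncfun P N0 s) :
  is_nc f <-> linear_tail (tail_of f) /\ respects_tail (tail_of f).
Proof.
split=> [[lf [rf rfs]]|[lf rf]].
  split=> [m X pX|].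
    split=> [r Z Z' x|Z]; last first.
      by apply: (linear_tail_comb (lincomb_lmul _ _)) => _; exact: lf.
    by rewrite !app_tail_of sclmx_regular lmulmxDl lmulZmx.
  split=> [m m' X X' S pX pX' SX Z|m X pX Z]; last first.
    by apply: (respects_tail_comb (lincomb_lmul _ _)) => _; exact: rfs.
  apply/shift_tailP => x; rewrite app_tail_of rmulmx_regular shift_lmul.
  have /shift_tailP/(_ x) := rf _ _ X X' S pX pX' SX.
  by rewrite app_tail_map -lmulmxA => ->.
(* The values of f are reassembled from their rows. *)
have hf m X : lincomb (fun i : 'I_m => delta_mx i 0 : 'M_(m, 1))
    (fun i => tail_of f m X (delta_mx 0 i)) (f m X).
  move=> x; under eq_bigr => i _ do rewrite app_tail_of lmulmxA mul_delta_mx.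
  rewrite -(lin_from_sum (lmulmx_linl _)) -[LHS]lmul1mx; congr (lmulmx _ _).
  apply/matrixP=> i j; rewrite summxE (bigD1 i) //= big1 ?addr0 => [|l li].
    by rewrite !mxE eqxx eq_sym.
  by rewrite !mxE eq_sym (negPf li).
split=> [m X pX|].
  apply: (linear_tail_comb (hf m X)) => i.
  exact: (linear_tail_slice (c := rslot) _ lf pX).
split=> [m m' X X' S pX pX' SX|m X pX]; last first.
  apply: (respects_tail_comb (hf m X)) => i.
  exact: (respects_tail_slice (c := rslot) _ rf pX).
apply/shift_tailP => x; rewrite app_tail_map; apply: eq_lmulmx => Z.
rewrite lmulmxA -[Z *m S]rmulmx_regular -app_tail_of -shift_lmul.
exact: (@respects_tail_head R N0 1 rslot s 1 _ m X m' X' S Z x rf pX pX' SX).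
Qed.

(** The signatures agree by computation only once j is destructed, hence two branches with the same
    body. *)
Definition dup_tail_of s j : ncfun P N0 (dup P s j) -> nctail N0 1 (dupl (rslot :: s) j) 1 :=
  match j with
  | 0%N => fun F => tail_of F
  | j'.+1 => fun F => tail_of F
  end.

Lemma nceq_dup_tail_of s j (F G : ncfun P N0 (dup P s j)) :
  nceq F G <-> teq (dup_tail_of F) (dup_tail_of G).
Proof. by case: j F G => [|j] F G; exact: nceq_tail_of. Qed.

Lemma is_nc_dup_tail_of s j (F : ncfun P N0 (dup P s j)) :
  is_nc F -> linear_tail (dup_tail_of F) /\ respects_tail (dup_tail_of F).
Proof. by case: j F => [|j] F /is_nc_tail_of. Qed.

(** For j = 0, the row [Z 0] times the value at the block matrix is Z times its upper rows, which is
    the factor [I 0] in the operator. *)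
Lemma Delta_tail_of s j (f : ncfun P N0 s) :
  teq (dup_tail_of (Delta j f)) (Delta_tail j (tail_of f)).
Proof.
case: j => [|j]; last first.
  case=> [[m X pX Z] x].
  rewrite -[LHS]/(app (tail_of (Delta j.+1 f) m X Z) x) app_tail_of.
  rewrite -[RHS]/(app (Delta_tail j (tail_of f m X Z)) x).
  by rewrite Delta_tail_lmul.
case=> [[m1 X1 pX1 Z] [[m2 X2 pX2 W] x]].
rewrite -[RHS]/(app (Delta_tail 0 (tail_of f) m1 X1 Z m2 X2 W) x) Delta_tail0E.
pose TZ := tail_map (fun p Y => lmulmx (Z : 'M[R]_(1, m1)) Y) (Delta 0 f X1 m2 X2 W).
rewrite -[LHS]/(app TZ x) /TZ !app_tail_map lower_tailE shift_lmul lmulmx_scl.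
set A := app _ x; rewrite -[A in RHS]vsubmxK.
by rewrite lmul_row_col lmul0mx addr0.
Qed.

Lemma tail_of_ecast s s' (e : s = s') (f : ncfun P N0 s) :
  tail_of (ecast t (ncfun P N0 t) e f) =
  ecast t (nctail N0 1 t 1) (congr1 (cons rslot) e) (tail_of f).
Proof. by case: _ / e. Qed.

Lemma teq_ecast a (s s' : seq (slot R)) n (e : s = s') (G G' : nctail N0 a s n) :
  teq G G' -> teq (ecast t (nctail N0 a t n) e G) (ecast t (nctail N0 a t n) e G').
Proof. by case: _ / e. Qed.

(** [dupC] and [duplC] are transparent, so the two transports can be matched case by case. *)
Lemma nceq_Delta2 s i j (hij : (i <= j)%N)
    (F : ncfun P N0 (dup P s i)) (G : ncfun P N0 (dup P s j)) :
  nceq (ecast t (ncfun P N0 t) (dupC P s hij) (Delta j.+1 F)) (Delta i G) <->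
  teq (ecast t (nctail N0 1 t 1) (duplC (rslot :: s) hij) (Delta_tail j.+1 (dup_tail_of F)))
      (Delta_tail i (dup_tail_of G)).
Proof.
have teqE a s' n (A A' B B' : nctail N0 a s' n) :
  teq A A' -> teq B B' -> (teq A B <-> teq A' B').
  by move=> hA hB; split=> h x; [rewrite -hA -hB|rewrite hA hB]; exact: h.
apply: (iff_trans (nceq_tail_of _ _)).
case: i j hij F G => [|i] [|j] hij F G //.
- have hF := @Delta_tail_of (Slot P (dmod P) :: s) 1 F.
  exact: teqE hF (@Delta_tail_of (Slot P (dmod P) :: s) 0 G).
- have hF := @Delta_tail_of (Slot P (dmod P) :: s) j.+2 F.
  exact: teqE hF (@Delta_tail_of (dupl s j) 0 G).
rewrite -[dupC P s hij]/(duplC s (hij : (i <= j)%N)) tail_of_ecast.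
have hF := @Delta_tail_of (dupl s i) j.+2 F.
exact: teqE (teq_ecast _ hF) (@Delta_tail_of (dupl s j) i.+1 G).
Qed.

End ScalarSlot.

(** * Application to functions with points X^0, ..., X^k *)

Lemma adm_slots_map (R : comPzRingType) (I : Type) (f : I -> slot R) (l : seq I) :
  (forall i, right_admissible (dset (sdom (f i)))) -> adm_slots (map f l).
Proof. by move=> h; elim: l => [|i l IHl] //=; split. Qed.

Lemma pos_slots_map (R : comPzRingType) (I : Type) (f : I -> slot R) (l : seq I) :
  (forall i, nc_set (dset (sdom (f i)))) -> pos_slots (map f l).
Proof. by move=> h; elim: l => [|i l IHl] //=; split=> //; case: (h i). Qed.

Theorem theorem2p1 (R : comPzRingType) (k : nat) (hk : (0 < k)%N)
    (M N : 'I_k.+1 -> lmodType R) (Om : forall j : 'I_k.+1, ncsubset (M j))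
    (hOm : forall j : 'I_k.+1, nc_set (Om j))
    (hadm : forall j : 'I_k.+1, right_admissible (Om j))
    (F : forall j : 'I_k.+1,
       ncfun (Domain (Om ord0)) (N ord0) (dup (Domain (Om ord0)) (slots N Om) j))
    (hF : forall j : 'I_k.+1, is_nc (F j)) :
  ((exists f : ncfun (Domain (Om ord0)) (N ord0) (slots N Om),
      is_nc f /\ forall j : 'I_k.+1, nceq (Delta j f) (F j))
   <->
   (forall (i j : 'I_k.+1) (hij : (i <= j)%N),
      nceq (ecast t (ncfun (Domain (Om ord0)) (N ord0) t)
              (dupC (Domain (Om ord0)) (slots N Om) hij) (Delta j.+1 (F i)))
           (Delta i (F j))))
  /\
  (forall f ftilde : ncfun (Domain (Om ord0)) (N ord0) (slots N Om),
     is_nc f -> (forall j : 'I_k.+1, nceq (Delta j f) (F j)) ->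
     is_nc ftilde -> (forall j : 'I_k.+1, nceq (Delta j ftilde) (F j)) ->
     exists c : vals (slots N Om) -> N ord0,
       klinear c /\
       forall (n : nat) (X : 'M[M ord0]_n), Om ord0 n X ->
       forall x : args (slots N Om) n,
         app (ftilde n X) x
         = app (f n X) x + \matrix_(alpha, omega) path_sum c x alpha omega).
Proof.
set P := Domain (Om ord0); set s := slots N Om.
(* The scalar slot takes up X^0, so slots are indexed by 0, ..., k like the operators. *)
have sz : size (rslot P :: s) = k.+1 by rewrite /= size_map size_enum_ord.
have adm : adm_slots (rslot P :: s).
  by split; [exact: hadm | apply: adm_slots_map => j; exact: hadm].
have pos : pos_slots (rslot P :: s).
  by split; [case: (hOm ord0) | apply: pos_slots_map => j; exact: hOm].
have lt_k j : (j < size (rslot P :: s))%N -> (j < k.+1)%N by rewrite sz.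
pose G : derivs (N ord0) 1 (rslot P :: s) 1 :=
  fun j hj => dup_tail_of (F (Ordinal (lt_k j hj))).
have lG j hj : linear_tail (G j hj) by case: (is_nc_dup_tail_of (hF (Ordinal (lt_k j hj)))).
have rG j hj : respects_tail (G j hj).
  by case: (is_nc_dup_tail_of (hF (Ordinal (lt_k j hj)))).
have derivG f : is_nc f -> (forall j : 'I_k.+1, nceq (Delta j f) (F j)) ->
    forall j hj, ncderiv (tail_of f) (G j hj).
  move=> /is_nc_tail_of [lf rf] hf j hj.
  have /nceq_dup_tail_of h := hf (Ordinal (lt_k j hj)).
  apply: ncderiv_teq (Delta_tail_ncderiv j adm lf rf) => // x.
  by rewrite -h Delta_tail_of.
split; first split.
- move=> [f [nf hf]] [i hi] [j hj] hij; apply/nceq_Delta2.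
  have hi' : (i < size (rslot P :: s))%N by rewrite sz.
  have hj' : (j < size (rslot P :: s))%N by rewrite sz.
  rewrite (bool_irrelevance hi (lt_k i hi')) (bool_irrelevance hj (lt_k j hj')).
  apply: (@compat_Delta _ _ 1 (rslot P :: s) 1 i j hij (G i hi') (G j hj')) => //.
  exact: ncderiv_compat lG (derivG f nf hf) hij.
- move=> hF2.
  have cG i j hi hj : (i <= j)%N -> compat (G i hi) (G j hj).
    move=> hij; apply: (@Delta_compat _ _ 1 (rslot P :: s) 1 i j hij) => //.
    exact/(nceq_Delta2 (s := s) (P := P) hij _ _)/(hF2 (Ordinal (lt_k i hi)) (Ordinal (lt_k j hj))).
  have lI := linear_integral lG.
  have dI j hj : ncderiv (integral G) (G j hj) by exact: ncderiv_integral.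
  have hI := of_tailK lI.
  pose f := of_tail (integral G).
  have df j hj : ncderiv (tail_of f) (G j hj) by exact: ncderiv_teq hI _ (dI j hj).
  have lf : linear_tail (tail_of f) by exact: linear_tail_comb (lincomb_teq hI) (fun=> lI).
  exists f; split; first by apply/is_nc_tail_of; split=> //; exact: ncderiv_respects lG df.
  move=> [j hj]; apply/nceq_dup_tail_of => x.
  have hj' : (j < size (rslot P :: s))%N by rewrite sz.
  rewrite Delta_tail_of (ncderiv_Delta_tail hj' adm lf (lG j hj') (rG j hj') (df j hj')).
  by rewrite (bool_irrelevance hj (lt_k j hj')).
move=> f f' nf hf nf' hf'.
(* Without any point X^0 the formula is vacuous and c = 0 serves. *)
have [[[m0 Y] /= pY]|noY] := classic (exists Y : {m & 'M[M ord0]_m}, Om ord0 (tag Y) (tagged Y));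
  last first.
  exists (fun _ => 0); split; first exact: klinear0.
  by move=> n X pX; case: noY; exists (existT (fun m => 'M[M ord0]_m) n X).
have m0_gt0 : (0 < m0)%N by case: (hOm ord0) => h _; exact: h pY.
pose g := tsub (tail_of f') (tail_of f).
have hg x : app g x = app (tail_of f') x - app (tail_of f) x by exact: app_tsub.
have fg : flat g := ncderiv_flat (derivG f nf hf) (derivG f' nf' hf') hg.
have lg : linear_tail g.
  apply: linear_tail_comb (lincomb_sub hg) _ => -[].
    by case/is_nc_tail_of: nf'.
  by case/is_nc_tail_of: nf.
(* Multiplication by e selects row 0, so gY is the first row of the difference of the two functions
   at Y. *)
pose e : 'M[R]_(1, m0) := \row_j (j == 0 :> nat)%:R.
pose gY : nctail (N ord0) 1 s m0 := g m0 Y (e : 'M[R^o]_(1, m0)).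
have lgY : linear_tail gY := linear_tail_slice (c := rslot P) _ lg pY.
exists (coef gY); split; first exact: klinear_coef.
move=> n X pX x; apply/matrixP=> al om; rewrite !mxE.
rewrite -coefP //; [|by case: pos|by case: fg => _; exact].
(* With this factorization, flatness at the scalar slot moves X to Y. *)
have eal : delta_mx 0 al = rmulmx (e : 'M[R^o]_(1, m0)) (unit_row R m0 al).
  rewrite rmulmx_regular; apply/matrixP=> i j; rewrite ord1 !mxE.
  rewrite (bigD1 (Ordinal m0_gt0)) //= big1 ?addr0.
    by rewrite !mxE !eqxx mul1r.
  by move=> l; rewrite -val_eqE /= => /negPf l0; rewrite !mxE l0 mul0r.
case: fg => fg _; have := fg n X m0 Y (unit_row R m0 al) (e : 'M[R^o]_(1, m0)) x pX pY.
rewrite -eal => <-.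
rewrite -[app (g _ _ _) _]/(app g (existT _ (@Arg R (rslot P) 1 n X pX (delta_mx 0 al)) x)) hg.
rewrite -[app (tail_of f') _]/(app (tail_of f' X (delta_mx 0 al)) x).
rewrite -[app (tail_of f) _]/(app (tail_of f X (delta_mx 0 al)) x).
by rewrite !app_tail_of [X in _ + X]mxE [X in _ + (_ + X)]mxE !lmul_delta addrC subrK.
Qed.
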